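(* Let $\Bbbk$ be a field, let $d,e\ge0$ be integers with $d+e\ge3$, let $c=d+e-1$, and let $L$ be the ideal of $2\times 2$ minors of the $2\times(c+1)$ matrix $$\mathbf{L}=\begin{pmatrix} y_{1,1}&\cdots&y_{1,d}&x_1&x_2&\cdots&x_{e-1}&x_e\\ y_{2,1}&\cdots&y_{2,d}&x_2&x_3&\cdots&x_e&0\end{pmatrix}$$ in $S=\Bbbk[y_{1,1},\dots,y_{2,d},x_1,\dots,x_e]$. Let $\pi_{\mathcal F}:P_{\mathcal F}=\Bbbk[T_{\alpha,\beta}:1\le\alpha<\beta\le c+1]\to\mathcal{F}(L)$ be the presentation of the special fiber ring sending $T_{\alpha,\beta}$ to the minor $\Delta_{\alpha,\beta}$ of $\mathbf{L}$ on columns $\alpha<\beta$. Then the Plücker relations $\mathrm{PLU}_{\alpha,\beta,\gamma,\delta}$ (for $1\le\alpha<\beta<\gamma<\delta\le c+1$) and the Laplace relations $\mathrm{LAP}_{\alpha,\beta,\gamma,\delta}$ (for $d+1\le\alpha<\beta<\gamma<\delta\le c+1$) form a Gröbner basis of the defining ideal $\ker(\pi_{\mathcal F})$ of $\mathcal{F}(L)$ with respect to the monomial order $\preceq$.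
   Context: The special fiber ring is $\mathcal{F}(L)=\Bbbk[\Delta_{\alpha,\beta}:1\le\alpha<\beta\le c+1]\subseteq S$. Plücker relations: for $1\le\alpha<\beta<\gamma<\delta\le c+1$, $$\mathrm{PLU}_{\alpha,\beta,\gamma,\delta}=T_{\alpha,\beta}T_{\gamma,\delta}-T_{\alpha,\gamma}T_{\beta,\delta}+T_{\alpha,\delta}T_{\beta,\gamma}.$$ Laplace relations: for $d+1\le\alpha<\beta<\gamma<\delta\le c$, $$\mathrm{LAP}_{\alpha,\beta,\gamma,\delta}=T_{\alpha,\beta}T_{\gamma+1,\delta+1}-T_{\alpha,\gamma}T_{\beta+1,\delta+1}+T_{\alpha,\delta}T_{\beta+1,\gamma+1}+T_{\beta,\gamma}T_{\alpha+1,\delta+1}-T_{\beta,\delta}T_{\alpha+1,\gamma+1}+T_{\gamma,\delta}T_{\alpha+1,\beta+1},$$ and for $d+1\le\alpha<\beta<\gamma<\delta=c+1$, $$\mathrm{LAP}_{\alpha,\beta,\gamma,c+1}=T_{\alpha,c+1}T_{\beta+1,\gamma+1}-T_{\beta,c+1}T_{\alpha+1,\gamma+1}+T_{\gamma,c+1}T_{\alpha+1,\beta+1}.$$ Monomial order $\preceq$ on $P_{\mathcal F}$: monomials are compared by the following rules, each used to break ties left by the previous ones. Let $\mathbf{e}_1,\dots,\mathbf{e}_{c+1}$ be the basis of $\mathbb{N}^{c+1}$. (i) Compare the multidegrees $\mathrm{mdeg}_1$, where $\mathrm{mdeg}_1(T_{\alpha,\beta})=\mathbf{e}_\alpha+\mathbf{e}_\beta$,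 by the graded reverse-lexicographic order on $\mathbb{N}^{c+1}$ induced by $\mathbf{e}_{c+1}>\mathbf{e}_c>\dots>\mathbf{e}_1$. (ii) Compare the multidegrees $\mathrm{mdeg}_2$, where $\mathrm{mdeg}_2(T_{\alpha,\beta})=\mathbf{e}_\alpha$, by the graded reverse-lexicographic order induced by $\mathbf{e}_1>\mathbf{e}_2>\dots>\mathbf{e}_{c+1}$. (iii) Compare by the lexicographic order induced by $T_{1,2}>T_{1,3}>\dots>T_{1,c+1}>T_{2,3}>\dots>T_{c,c+1}$. *)

(* Defs.v *)
From mathcomp Require Import all_boot all_order all_algebra.
From mathcomp Require Export mpoly.

Set Implicit Arguments.
Unset Strict Implicit.
Unset Printing Implicit Defensive.

Import GRing.Theory.
Local Open Scope ring_scope.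

Section LexOrders.
Variable I : finType.
Implicit Types (r : rel I) (u v : I -> nat).

(* [r i j] means that the variable [i] is greater than the variable [j]: the
   greatest variable at which the exponents differ decides. *)
Definition lex_lt r u v : bool :=
  [exists i, (u i < v i)%N && [forall j, r j i ==> (u j == v j)]].

(* The same convention for [r]. In equal degrees the smallest variable at
   which the exponents differ decides, and the larger exponent there gives the
   smaller monomial; hence the converse relation and the swapped arguments. *)
Definition grevlex_lt r u v : bool :=
  (\sum_i u i < \sum_i v i)%N ||
  (\sum_i u i == \sum_i v i)%N && lex_lt (fun i j => r j i) v u.

Definition strict_total r : Prop :=
  [/\ irreflexive r, transitive r & forall i j, i != j -> r i j || r j i].

Lemma lex_lt_irr r u : lex_lt r u u = false.
Proof. by apply/existsP => -[i /andP[]]; rewrite ltnn. Qed.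

Lemma lex_lt_trans r u v w :
  strict_total r -> lex_lt r u v -> lex_lt r v w -> lex_lt r u w.
Proof.
move=> [irr tr tot] /existsP[i /andP[ui /forallP hi]]
  /existsP[j /andP[vj /forallP hj]].
have Hi k : r k i -> u k = v k by move=> rk; apply/eqP/(implyP (hi k)).
have Hj k : r k j -> v k = w k by move=> rk; apply/eqP/(implyP (hj k)).
case: (eqVneq i j) => [eij|nij].
  subst j; apply/existsP; exists i; rewrite (ltn_trans ui vj) /=.
  by apply/forallP => k; apply/implyP => rk; rewrite Hi // Hj.
case/orP: (tot _ _ nij) => rij.
  apply/existsP; exists i; rewrite -(Hj _ rij) ui /=.
  by apply/forallP => k; apply/implyP => rk; rewrite Hi // Hj // (tr _ _ _ rk).
apply/existsP; exists j; rewrite (Hi _ rij) vj /=.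
by apply/forallP => k; apply/implyP => rk; rewrite Hi ?Hj // (tr _ _ _ rk).
Qed.

Lemma lex_lt_total r u v :
  strict_total r -> ~ (u =1 v) -> lex_lt r u v || lex_lt r v u.
Proof.
move=> [irr tr _] neq.
have [i0 hi0] : exists i, u i != v i.
  by apply/existsP; apply: contra_notT neq => /existsPn h i;
     apply/eqP; move: (h i); rewrite negbK.
case: (@arg_minnP I i0 (fun i => u i != v i) (fun i => #|[pred j | r j i]|) hi0) => i ni imin.
have hlow j : r j i -> u j = v j.
  move=> rji; apply/eqP; apply: contraTT isT => nj.
  move: (imin j nj); rewrite leqNgt => /negP[].
  apply: proper_card; apply/properP; split.
    by apply/subsetP => k; rewrite !inE => /tr; apply.
  by exists j; rewrite !inE ?irr.
case: ltngtP ni => // h _; apply/orP; [left | right];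
  apply/existsP; exists i; rewrite h /=; apply/forallP => k;
  by apply/implyP => /hlow ->.
Qed.

Lemma lex_lt_add r u v w :
  lex_lt r u v -> lex_lt r (fun i => u i + w i)%N (fun i => v i + w i)%N.
Proof.
case/existsP=> i /andP[hi /forallP h]; apply/existsP; exists i.
rewrite ltn_add2r hi; apply/forallP => j; rewrite eqn_add2r; exact: h.
Qed.

Lemma eq_lex_lt r u u' v v' :
  u =1 u' -> v =1 v' -> lex_lt r u v = lex_lt r u' v'.
Proof.
move=> eu ev; apply: eq_existsb => i; rewrite eu ev; congr (_ && _).
by apply: eq_forallb => j; rewrite eu ev.
Qed.

Lemma strict_total_converse r :
  strict_total r -> strict_total (fun i j => r j i).
Proof.
case=> irr tr tot; split=> // [x y z ? /tr|i j /tot]; first exact.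
by rewrite orbC.
Qed.

Lemma grevlex_lt_irr r u : grevlex_lt r u u = false.
Proof. by rewrite /grevlex_lt ltnn lex_lt_irr andbF. Qed.

Lemma grevlex_lt_trans r u v w :
  strict_total r -> grevlex_lt r u v -> grevlex_lt r v w -> grevlex_lt r u w.
Proof.
move=> st; rewrite /grevlex_lt.
case/orP => [uv|/andP[/eqP-> uv]] /orP[vw|/andP[/eqP<- vw]].
- by rewrite (ltn_trans uv vw).
- by rewrite uv.
- by rewrite vw.
- by rewrite eqxx (lex_lt_trans (strict_total_converse st) vw uv) orbT.
Qed.

Lemma grevlex_lt_total r u v :
  strict_total r -> ~ (u =1 v) -> grevlex_lt r u v || grevlex_lt r v u.
Proof.
move=> st neq; rewrite /grevlex_lt.
case: (ltngtP (\sum_i u i)%N) => //= _.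
by rewrite orbC; apply: lex_lt_total => //; apply: strict_total_converse.
Qed.

Lemma grevlex_lt_add r u v w :
  grevlex_lt r u v ->
  grevlex_lt r (fun i => u i + w i)%N (fun i => v i + w i)%N.
Proof.
rewrite /grevlex_lt !big_split /= ltn_add2r eqn_add2r.
by case/orP => [->//|/andP[-> h]]; rewrite /= lex_lt_add ?orbT.
Qed.

Lemma eq_grevlex_lt r u u' v v' :
  u =1 u' -> v =1 v' -> grevlex_lt r u v = grevlex_lt r u' v'.
Proof.
move=> eu ev; rewrite /grevlex_lt (eq_lex_lt _ ev eu).
by rewrite (eq_bigr _ (fun i _ => eu i)) (eq_bigr _ (fun i _ => ev i)).
Qed.

End LexOrders.

(* For a total order compatible with multiplication, [mo_ge0] is equivalent to
   being a well-order, by Dickson's lemma. *)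
Record monomial_order (N : nat) := MonomialOrder {
  mo_le :> rel 'X_{1..N};
  mo_anti : antisymmetric mo_le;
  mo_trans : transitive mo_le;
  mo_total : total mo_le;
  mo_ge0 : forall m, mo_le 0%MM m;
  mo_add : forall m1 m2 m, mo_le m1 m2 -> mo_le (m1 + m)%MM (m2 + m)%MM }.

Section Groebner.
Variables (k : fieldType) (N : nat) (le : monomial_order N).
Implicit Types (I G : {mpoly k[N]} -> Prop) (f g p : {mpoly k[N]}).

Definition ideal_gen G p : Prop :=
  exists s : seq ({mpoly k[N]} * {mpoly k[N]}),
    (forall u, u \in s -> G u.2) /\ p = \sum_(u <- s) u.1 * u.2.

Definition is_lead_monomial f (m : 'X_{1..N}) : Prop :=
  m \in msupp f /\ forall m', m' \in msupp f -> le m' m.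

(* A zero member of [G] has no leading monomial and contributes nothing. *)
Definition lead_monomials G p : Prop :=
  exists g m, [/\ G g, is_lead_monomial g m & p = 'X_[m]].

Definition initial_ideal I : {mpoly k[N]} -> Prop :=
  ideal_gen (lead_monomials I).

Definition groebner_basis G I : Prop :=
  (forall g, G g -> I g) /\
  (forall p, ideal_gen (lead_monomials G) p <-> initial_ideal I p).

End Groebner.

(* Throughout [n] stands for c + 1, and columns are numbered from 0: the
   element [i] of ['I_n] is the column [i + 1] of the matrix. *)
Definition colpair (n : nat) : predArgType :=
  {p : 'I_n * 'I_n | (p.1 < p.2)%N}.

Definition nvars (n : nat) : nat := #|{: colpair n}|.

Section PluckerOrder.
Variable n : nat.
Implicit Types (m : 'X_{1..nvars n}) (p q : colpair n).

Definition exponent m p : nat := m (enum_rank p).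

Definition multideg1 m : 'X_{1..n} :=
  (\sum_(p : colpair n) (U_((val p).1) + U_((val p).2)) *+ exponent m p)%MM.

Definition multideg2 m : 'X_{1..n} :=
  (\sum_(p : colpair n) U_((val p).1) *+ exponent m p)%MM.

(* T_{1,2} > T_{1,3} > ... > T_{1,c+1} > T_{2,3} > ... > T_{c,c+1} *)
Definition colpair_gt : rel (colpair n) := fun p q =>
  ((val p).1 < (val q).1)%N ||
  ((val p).1 == (val q).1) && ((val p).2 < (val q).2)%N.

(* e_{c+1} > ... > e_1 for the first multidegree, e_1 > ... > e_{c+1} for the
   second. *)
Definition plucker_lt m1 m2 : bool :=
  let d1 := multideg1 m1 in let d1' := multideg1 m2 in
  let d2 := multideg2 m1 in let d2' := multideg2 m2 in
  grevlex_lt (fun i j : 'I_n => (j < i)%N) d1 d1' ||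
  (d1 == d1') &&
  (grevlex_lt (fun i j : 'I_n => (i < j)%N) d2 d2' ||
   (d2 == d2') && lex_lt colpair_gt (exponent m1) (exponent m2)).

Definition plucker_le : rel 'X_{1..nvars n} :=
  fun m1 m2 => (m1 == m2) || plucker_lt m1 m2.

Lemma strict_total_ltn : strict_total (fun i j : 'I_n => (i < j)%N).
Proof.
split=> [i|j i l|i j nij]; [exact: ltnn | exact: ltn_trans |].
by rewrite -neq_ltn.
Qed.

Lemma strict_total_gtn : strict_total (fun i j : 'I_n => (j < i)%N).
Proof. exact: strict_total_converse strict_total_ltn. Qed.

Lemma strict_total_colpair : strict_total colpair_gt.
Proof.
split=> [p|q p s|p q npq]; rewrite /colpair_gt.
- by rewrite !ltnn andbF.
- case/orP=> [h1|/andP[/eqP-> h1]] /orP[h2|/andP[/eqP<- h2]].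
  + by rewrite (ltn_trans h1 h2).
  + by rewrite h1.
  + by rewrite h2.
  + by rewrite eqxx (ltn_trans h1 h2) orbT.
- have: (val p).1 != (val q).1 \/ (val p).2 != (val q).2.
    apply/orP; rewrite -negb_and; apply: contraNN npq => /andP[/eqP h1 /eqP h2].
    by apply/eqP/val_inj; case: (val p) (val q) h1 h2 => [? ?] [? ?] /= -> ->.
  rewrite -!val_eqE /=.
  by case: ltngtP => //= _ []; case: ltngtP.
Qed.

Lemma exponentD m1 m2 p :
  exponent (m1 + m2)%MM p = (exponent m1 p + exponent m2 p)%N.
Proof. exact: mnmDE. Qed.

Lemma exponent_inj m1 m2 : exponent m1 =1 exponent m2 -> m1 = m2.
Proof.
by move=> h; apply/mnmP => i; move: (h (enum_val i)); rewrite /exponent enum_valK.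
Qed.

Lemma multideg1D m1 m2 :
  multideg1 (m1 + m2)%MM = (multideg1 m1 + multideg1 m2)%MM.
Proof.
apply/mnmP => i; rewrite mnmDE !mnm_sumE -big_split /=; apply: eq_bigr => p _.
by rewrite !mulmnE exponentD mulnDr.
Qed.

Lemma multideg2D m1 m2 :
  multideg2 (m1 + m2)%MM = (multideg2 m1 + multideg2 m2)%MM.
Proof.
apply/mnmP => i; rewrite mnmDE !mnm_sumE -big_split /=; apply: eq_bigr => p _.
by rewrite !mulmnE exponentD mulnDr.
Qed.

Lemma mdeg_multideg1 m : mdeg (multideg1 m) = (mdeg m * 2)%N.
Proof.
rewrite /multideg1 mdeg_sum mdegE big_distrl /=.
rewrite (reindex (@enum_rank (colpair n))) /=; last exact/onW_bij/enum_rank_bij.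
by apply: eq_bigr => p _; rewrite mdegMn mdegD !mdeg1 mulnC.
Qed.

Lemma plucker_lt_irr m : plucker_lt m m = false.
Proof. by rewrite /plucker_lt !grevlex_lt_irr lex_lt_irr !andbF. Qed.

Lemma plucker_lt_trans : transitive plucker_lt.
Proof.
move=> m2 m1 m3; rewrite /plucker_lt /=.
case/orP => [h1|/andP[/eqP-> h1]] /orP[h2|/andP[/eqP<- h2]].
- by rewrite (grevlex_lt_trans strict_total_gtn h1 h2).
- by rewrite h1.
- by rewrite h2.
rewrite eqxx /=; apply/orP; right.
case/orP: h1 => [h1|/andP[/eqP-> h1]]; case/orP: h2 => [h2|/andP[/eqP<- h2]].
- by rewrite (grevlex_lt_trans strict_total_ltn h1 h2).
- by rewrite h1.
- by rewrite h2.
- by rewrite eqxx (lex_lt_trans strict_total_colpair h1 h2) orbT.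
Qed.

Lemma plucker_lt_total m1 m2 :
  m1 != m2 -> plucker_lt m1 m2 || plucker_lt m2 m1.
Proof.
move=> ne; rewrite /plucker_lt /=.
case: (eqVneq (multideg1 m1) (multideg1 m2)) => [->|n1]; last first.
  by rewrite !orbF; apply: (grevlex_lt_total strict_total_gtn) => /mnmP /eqP;
     rewrite (negbTE n1).
rewrite grevlex_lt_irr /=.
case: (eqVneq (multideg2 m1) (multideg2 m2)) => [->|n2]; last first.
  by rewrite !orbF; apply: (grevlex_lt_total strict_total_ltn) => /mnmP /eqP;
     rewrite (negbTE n2).
rewrite grevlex_lt_irr /=; apply: (lex_lt_total strict_total_colpair).
by move/exponent_inj/eqP; rewrite (negbTE ne).
Qed.

Lemma plucker_lt_add m1 m2 m :
  plucker_lt m1 m2 -> plucker_lt (m1 + m)%MM (m2 + m)%MM.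
Proof.
have grevlexD r (u v w : 'X_{1..n}) : grevlex_lt r u v ->
    grevlex_lt r (u + w)%MM (v + w)%MM.
  move=> /(grevlex_lt_add w); congr is_true.
  by apply: eq_grevlex_lt => i; rewrite mnmDE.
rewrite /plucker_lt /= !multideg1D !multideg2D.
case/orP => [/grevlexD-> //|/andP[/eqP-> h]]; rewrite eqxx /=; apply/orP; right.
case/orP: h => [/grevlexD-> //|/andP[/eqP-> h]]; rewrite eqxx /=.
apply/orP; right; move/(lex_lt_add (exponent m)): h; congr is_true.
by apply: eq_lex_lt => p; rewrite exponentD.
Qed.

Lemma plucker_le_anti : antisymmetric plucker_le.
Proof.
move=> m1 m2 /andP[/orP[/eqP//|h1] /orP[/eqP//|h2]].
by move: (plucker_lt_trans h1 h2); rewrite plucker_lt_irr.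
Qed.

Lemma plucker_le_trans : transitive plucker_le.
Proof.
move=> m2 m1 m3 /orP[/eqP-> //|h1] /orP[/eqP<-|h2].
  by rewrite /plucker_le h1 orbT.
by rewrite /plucker_le (plucker_lt_trans h1 h2) orbT.
Qed.

Lemma plucker_le_total : total plucker_le.
Proof.
move=> m1 m2; rewrite /plucker_le [m2 == m1]eq_sym.
by case: eqVneq => //= /plucker_lt_total.
Qed.

Lemma plucker_le0 m : plucker_le 0%MM m.
Proof.
rewrite /plucker_le; case: (eqVneq 0%MM m) => //= ne.
apply/orP; left; rewrite /grevlex_lt -!mdegE !mdeg_multideg1 mdeg0.
by rewrite muln_gt0 lt0n mdeg_eq0 eq_sym ne.
Qed.

Lemma plucker_le_add m1 m2 m :
  plucker_le m1 m2 -> plucker_le (m1 + m)%MM (m2 + m)%MM.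
Proof.
case/orP=> [/eqP->|h]; first by rewrite /plucker_le eqxx.
by rewrite /plucker_le plucker_lt_add ?orbT.
Qed.

Definition plucker_order : monomial_order (nvars n) :=
  MonomialOrder plucker_le_anti plucker_le_trans plucker_le_total
    plucker_le0 plucker_le_add.

End PluckerOrder.

Section Relations.
Variables (k : fieldType) (d e : nat).
Local Notation n := (d + e)%N.
Local Notation S := {mpoly k[d + d + e]}.
Local Notation P := {mpoly k[nvars n]}.

Definition yvar1 (j : 'I_d) : S := 'X_(lshift e (lshift d j)).
Definition yvar2 (j : 'I_d) : S := 'X_(lshift e (rshift d j)).
Definition xvar (i : 'I_e) : S := 'X_(rshift (d + d) i).

Definition xvar_next (i : 'I_e) : S :=
  if insub i.+1 is Some i' then xvar i' else 0.

Definition Lmx : 'M[S]_(2, n) :=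
  row_mx (col_mx (\row_j yvar1 j) (\row_j yvar2 j) : 'M_(1 + 1, d))
         (col_mx (\row_i xvar i) (\row_i xvar_next i) : 'M_(1 + 1, e)).

Definition Delta (a b : 'I_n) : S := \det (colsub (tnth [tuple a; b]) Lmx).

(* The presentation of the special fiber ring, viewed in the ambient ring [S]:
   its image is the subalgebra generated by the minors. *)
Definition pi_F (f : P) : S :=
  f \mPo [tuple Delta (val (enum_val i)).1 (val (enum_val i)).2 | i < nvars n].

Definition ker_pi_F (f : P) : Prop := pi_F f = 0.

(* The value 0 for a >= b is a dummy one. *)
Definition Tvar (a b : 'I_n) : P :=
  if insub (a, b) is Some p then 'X_(enum_rank (p : colpair n)) else 0.

Definition PLU (a b c g : 'I_n) : P :=
  Tvar a b * Tvar c g - Tvar a c * Tvar b g + Tvar a g * Tvar b c.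

(* [ordS] is the cyclic successor; it is only used below on elements of ['I_n]
   other than the last one, where it is the usual successor. *)
Definition LAP (a b c g : 'I_n) : P :=
  Tvar a b * Tvar (ordS c) (ordS g) - Tvar a c * Tvar (ordS b) (ordS g)
  + Tvar a g * Tvar (ordS b) (ordS c) + Tvar b c * Tvar (ordS a) (ordS g)
  - Tvar b g * Tvar (ordS a) (ordS c) + Tvar c g * Tvar (ordS a) (ordS b).

Definition LAP_last (a b c g : 'I_n) : P :=
  Tvar a g * Tvar (ordS b) (ordS c) - Tvar b g * Tvar (ordS a) (ordS c)
  + Tvar c g * Tvar (ordS a) (ordS b).

Definition plucker_relation (f : P) : Prop :=
  exists a b c g : 'I_n, (a < b < c)%N /\ (c < g)%N /\ f = PLU a b c g.

Definition laplace_relation (f : P) : Prop :=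
  exists a b c g : 'I_n,
    [/\ (d <= a)%N, (a < b < c)%N, (c < g)%N &
        (g.+1 < n)%N /\ f = LAP a b c g \/ g.+1 = n /\ f = LAP_last a b c g].

Definition plucker_laplace (f : P) : Prop :=
  plucker_relation f \/ laplace_relation f.

End Relations.

(* Main.v *)
Require Import Defs.
From HB Require Import structures.
From mathcomp Require Import all_boot all_order all_algebra.
From mathcomp Require Import zify ring.

(** The leading monomials of the relations are the products of two crossing
    edges [T_{a,c} T_{b,g}] and the products [T_{a,b} T_{c,g}] with
    [d + 2 <= a < b <= c < g].  Reduction by the relations rewrites every
    element of the fiber ring in terms of standard monomials, those divisible
    by none of these, so everything rests on the linear independence of the
    standard monomials in the minors, which is proved by specialization.  Let
    [(v_j, w_j)] be the columns, so that [v_j = w_{j-1}] from the second column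
    of the Hankel block on; truncate the matrix after a column [l] and put
    [w_l = 0] (for the whole matrix this holds if [e > 0] and is harmless if
    [e = 0]).  Consider a linear relation between standard monomials,
    homogeneous in each generic column.
    - Killing [w_{l-1}] and [v_l] kills column [l] and truncates the matrix
      before it.  Hence, by induction on [l], every monomial of the relation
      contains an edge at [l].
    - Kill [w_0], ..., [w_d], one at a time.  If some monomials survive the
      killing of [w_i], go on with these.  Otherwise the crossing condition
      yields one edge, [(h, i)] with [h < i] or [(i, l)], common to all the
      monomials; divide by it and use induction on the degree.
    - Once [w_0, ..., w_d] are zero, the images of the remaining monomials have
      distinct initial terms: [(h, j)] gives [v_h w_j] for [h <= d], and [(i, j)]
      gives [w_i w_{j-1}] for [i > d]. *)

Set Implicit Arguments.
Unset Strict Implicit.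
Unset Printing Implicit Defensive.

Import GRing.Theory.
Local Open Scope ring_scope.

(** * Restriction, division and initial terms of polynomials *)

Section MpolyExtra.
Variable k : fieldType.

Definition mrestr n (Q : pred 'X_{1..n}) (f : {mpoly k[n]}) : {mpoly k[n]} :=
  \sum_(m <- msupp f | Q m) f@_m *: 'X_[m].

Lemma mcoeff_mrestr n (Q : pred 'X_{1..n}) f m :
  (mrestr Q f)@_m = if Q m then f@_m else 0.
Proof.
rewrite /mrestr raddf_sum /= -big_filter.
have -> : \sum_(i <- [seq i <- msupp f | Q i]) (f@_i *: 'X_[i])@_m
  = \sum_(i <- [seq i <- msupp f | Q i] | i == m) f@_m.
  rewrite [RHS]big_mkcond /=; apply: eq_bigr => i _.
  by rewrite mcoeffZ mcoeffX; case: eqP => [->|_]; rewrite ?mulr1 ?mulr0.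
case mm: (m \in [seq i <- msupp f | Q i]).
  rewrite (big_rem m) //= eqxx big1_seq ?addr0.
    by move: mm; rewrite mem_filter => /andP[->].
  move=> i /andP[/eqP-> ]; rewrite mem_rem_uniq ?filter_uniq ?msupp_uniq //.
  by rewrite !inE eqxx.
rewrite big1_seq => [|i /andP[/eqP->]]; last by rewrite mm.
move: mm; rewrite mem_filter; case: (Q m) => //= /negbT.
by rewrite -mcoeff_eq0 => /eqP.
Qed.

Lemma msupp_mrestr n (Q : pred 'X_{1..n}) f m :
  (m \in msupp (mrestr Q f)) = (m \in msupp f) && Q m.
Proof.
by rewrite !mcoeff_msupp mcoeff_mrestr; case: (Q m); rewrite ?eqxx ?andbT ?andbF.
Qed.

Lemma comp_mrestr n p (Q : pred 'X_{1..n}) f (lq : n.-tuple {mpoly k[p]}) :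
  (forall m, m \in msupp f -> ~~ Q m -> 'X_[m] \mPo lq = 0) ->
  mrestr Q f \mPo lq = f \mPo lq.
Proof.
move=> h; rewrite (comp_mpolyEX f) /mrestr raddf_sum /= big_mkcond.
apply: eq_big_seq => m mf; rewrite comp_mpolyZ.
by case: ifPn => // /h ->; rewrite ?scaler0.
Qed.

Lemma comp_mpoly_comp n p q (f : {mpoly k[n]}) (lq : n.-tuple {mpoly k[p]})
    (lr : p.-tuple {mpoly k[q]}) (ls : n.-tuple {mpoly k[q]}) :
  (forall t, tnth lq t \mPo lr = tnth ls t) ->
  (f \mPo lq) \mPo lr = f \mPo ls.
Proof.
move=> h; rewrite !(comp_mpolyEX f) raddf_sum /=; apply: eq_bigr => m _.
rewrite comp_mpolyZ !comp_mpolyX rmorph_prod; congr (_ *: _).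
by apply: eq_bigr => t _; rewrite rmorphXn /= h.
Qed.

Lemma eq_comp_mpoly n p (f : {mpoly k[n]}) (lq ls : n.-tuple {mpoly k[p]}) :
  (forall m t, m \in msupp f -> (0 < m t)%N -> tnth lq t = tnth ls t) ->
  f \mPo lq = f \mPo ls.
Proof.
move=> h; rewrite !(comp_mpolyEX f); apply: eq_big_seq => m mf.
rewrite !comp_mpolyX; congr (_ *: _); apply: eq_bigr => t _.
by case: (posnP (m t)) => [->|/h->]; rewrite ?expr0.
Qed.

Lemma comp_mpolyX_eq0 n p (m : 'X_{1..n}) (lq : n.-tuple {mpoly k[p]}) t :
  (0 < m t)%N -> tnth lq t = 0 -> 'X_[m] \mPo lq = 0.
Proof.
move=> mt lt; rewrite comp_mpolyX (bigD1 t) //= lt expr0n.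
by rewrite gtn_eqF // mul0r.
Qed.

Lemma mpoly_divX n (f : {mpoly k[n]}) t :
  (forall m, m \in msupp f -> (0 < m t)%N) ->
  exists2 g, f = g * 'X_t & forall m, (m \in msupp g) = ((U_(t) + m)%MM \in msupp f).
Proof.
move=> h; pose g := \sum_(m <- msupp f) f@_m *: 'X_[m - U_(t)].
have E : f = g * 'X_t.
  rewrite [LHS]mpolyE mulr_suml; apply: eq_big_seq => u uf.
  rewrite -scalerAl -mpolyXD submK //; apply/mnm_lepP => i.
  by rewrite mnm1E; case: eqP => // <-; apply: h.
by exists g => // m; rewrite !mcoeff_msupp [in RHS]E mcoeffMX.
Qed.

Lemma mpoly_supp0 n (f : {mpoly k[n]}) : (forall m, m \notin msupp f) -> f = 0.
Proof. by move=> h; apply/mpolyP => m; rewrite mcoeff0; apply/memN_msupp_eq0. Qed.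

(** * Weights, weighted homogeneity and initial terms *)

Definition wgt n (w : 'I_n -> nat) (m : 'X_{1..n}) : nat := \sum_i m i * w i.

Lemma wgtD n w (m1 m2 : 'X_{1..n}) : wgt w (m1 + m2) = (wgt w m1 + wgt w m2)%N.
Proof. by rewrite /wgt -big_split; apply: eq_bigr => i _; rewrite mnmDE mulnDl. Qed.

Lemma wgt0 n w : wgt w (0%MM : 'X_{1..n}) = 0%N.
Proof. by rewrite /wgt big1 // => i _; rewrite mnm0E. Qed.

Lemma wgtU n w (i : 'I_n) : wgt w U_(i)%MM = w i.
Proof.
rewrite /wgt (bigD1 i) //= mnm1E eqxx mul1n big1 ?addn0 // => j ji.
by rewrite mnm1E eq_sym (negbTE ji).
Qed.

Definition whomog n (w : 'I_n -> nat) (D : nat) (p : {mpoly k[n]}) : Prop :=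
  forall m, m \in msupp p -> wgt w m = D.

Lemma whomogM n w (p q : {mpoly k[n]}) D E :
  whomog w D p -> whomog w E q -> whomog w (D + E) (p * q).
Proof.
move=> hp hq m /msuppM_le /allpairsP[[a b] /= [ap bq ->]].
by rewrite wgtD (hp _ ap) (hq _ bq).
Qed.

Lemma whomog1 n w : whomog w 0 (1 : {mpoly k[n]}).
Proof. by move=> m; rewrite msupp1 inE => /eqP->; rewrite wgt0. Qed.

Lemma whomogB n w (p q : {mpoly k[n]}) D :
  whomog w D p -> whomog w D q -> whomog w D (p - q).
Proof.
by move=> hp hq m /msuppB_le; rewrite mem_cat => /orP[/hp|/hq].
Qed.

Lemma whomogX n w m : whomog w (wgt w m) ('X_[m] : {mpoly k[n]}).
Proof. by move=> u; rewrite msuppX inE => /eqP->. Qed.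

Lemma whomog0 n w D : whomog w D (0 : {mpoly k[n]}).
Proof. by move=> u; rewrite msupp0. Qed.

Lemma whomog_comp n p w (lq : n.-tuple {mpoly k[p]}) (c : 'I_n -> nat) m :
  (forall t, whomog w (c t) (tnth lq t)) ->
  whomog w (wgt c m) ('X_[m] \mPo lq).
Proof.
move=> h; rewrite comp_mpolyX /wgt.
apply: (big_ind2 (fun D q => whomog w D q)); first exact: whomog1.
  by move=> *; apply: whomogM.
move=> t _; elim: (m t) => [|j IH]; first by rewrite expr0; apply: whomog1.
by rewrite exprS mulSn; apply: whomogM.
Qed.

(** The term of strictly least weight. The weight may have ties among the other terms, so it can
    stand in for a monomial order. *)
Definition winit n (w : 'I_n -> nat) (p : {mpoly k[n]}) (u : 'X_{1..n}) : Prop :=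
  u \in msupp p /\ forall m, m \in msupp p -> m != u -> (wgt w u < wgt w m)%N.

Lemma winit_le n w (p : {mpoly k[n]}) u m :
  winit w p u -> m \in msupp p -> (wgt w u <= wgt w m)%N.
Proof. by move=> [_ h] mp; case: (eqVneq m u) => [->//|/(h _ mp)/ltnW]. Qed.

Lemma winitM n w (p q : {mpoly k[n]}) u v :
  winit w p u -> winit w q v -> winit w (p * q) (u + v)%MM.
Proof.
move=> hp hq.
have [[up hp'] [vq hq']] := (hp, hq).
have key a b : a \in msupp p -> b \in msupp q -> (a, b) != (u, v) ->
    (wgt w (u + v) < wgt w (a + b))%N.
  move=> ap bq; rewrite !wgtD.
  have := winit_le hp ap; have := winit_le hq bq.
  case: (eqVneq a u) => [->|na]; case: (eqVneq b v) => [->|nb]; rewrite ?eqxx //.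
  - by move: (hq' _ bq nb); lia.
  - by move: (hp' _ ap na); lia.
  - by move: (hp' _ ap na); lia.
split.
  (* Split off the term of [p] at [u]: by [key], the product of the rest with [q] cannot contain
     [u + v]. *)
  rewrite mcoeff_msupp; set p' := p - p@_u *: 'X_[u].
  have -> : p = p' + p@_u *: 'X_[u] by rewrite subrK.
  rewrite mulrDl mcoeffD -scalerAl mcoeffZ.
  have -> : ('X_[u] * q)@_(u + v) = q@_v by rewrite mulrC mcoeffMX.
  rewrite memN_msupp_eq0 ?add0r.
    by rewrite mulf_neq0 // -mcoeff_msupp.
  apply/negP => /msuppM_le /allpairsP[[a b] /= [ap bq e]].
  move: ap; rewrite (perm_mem (msupp_rem _ _)) mem_rem_uniq ?msupp_uniq //.
  rewrite !inE => /andP[na ap].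
  have /(key _ _ ap bq) : (a, b) != (u, v) by apply: contraNneq na => -[->].
  by rewrite -e ltnn.
move=> m /msuppM_le /allpairsP[[a b] /= [ap bq ->]] ne.
by apply: key => //; apply: contraNneq ne => -[-> ->].
Qed.

Lemma winit1 n w : winit w (1 : {mpoly k[n]}) 0%MM.
Proof. by split=> [|m]; rewrite msupp1 inE ?eqxx // => ->. Qed.

Lemma winit_comp n p w (lq : n.-tuple {mpoly k[p]}) (lm : 'I_n -> 'X_{1..p})
    (m : 'X_{1..n}) :
  (forall t, (0 < m t)%N -> winit w (tnth lq t) (lm t)) ->
  winit w ('X_[m] \mPo lq) (\sum_t lm t *+ m t)%MM.
Proof.
move=> h; rewrite comp_mpolyX.
apply: (big_ind2 (fun q u => winit w q u)); first exact: winit1.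
  by move=> *; apply: winitM.
move=> t _; case: (posnP (m t)) => [->|/h {}h].
  by rewrite expr0 mulm0n; apply: winit1.
elim: (m t) => [|j IH]; first by rewrite expr0 mulm0n; apply: winit1.
by rewrite exprS mulmS; apply: winitM.
Qed.

(** Choose [m] in the support of [f] with [lead m] of least weight [D]. In the image of another [u],
    every monomial other than [lead u] weighs more than [D], and [lead u] differs from [lead m]; so
    nothing cancels [lead m]. *)
Lemma winit_indep n p w (lq : n.-tuple {mpoly k[p]}) (lead : 'X_{1..n} -> 'X_{1..p})
    (f : {mpoly k[n]}) :
  (forall m, m \in msupp f -> winit w ('X_[m] \mPo lq) (lead m)) ->
  {in msupp f &, injective lead} ->
  f \mPo lq = 0 -> f = 0.
Proof.
move=> hw inj f0; apply: mpoly_supp0 => m0; apply/negP => m0f.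
have ex : exists D, has (fun m => wgt w (lead m) == D) (msupp f).
  by exists (wgt w (lead m0)); apply/hasP; exists m0.
case: (ex_minnP ex) => D /hasP[m mf /eqP eD] Dmin.
have : (f \mPo lq)@_(lead m) = 0 by rewrite f0 mcoeff0.
rewrite (comp_mpolyEX f) raddf_sum /= (big_rem m) //= big1_seq => [|u].
  rewrite addr0 mcoeffZ => /eqP; rewrite mulf_eq0 mcoeff_eq0 mf /=.
  by rewrite mcoeff_eq0 (hw _ mf).1.
rewrite mem_rem_uniq ?msupp_uniq // !inE => /andP[_ /andP[ne uf]].
rewrite mcoeffZ [X in _ * X]memN_msupp_eq0 ?mulr0 //; apply/negP => h.
have [_ /(_ _ h)] := hw _ uf.
have -> : (lead m != lead u) by apply: contraNneq ne => /inj ->.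
move=> /(_ isT); rewrite eD ltnNge Dmin //.
by apply/hasP; exists u.
Qed.

End MpolyExtra.

(** * Independence of the standard monomials *)

Section Independence.
Variables (k : fieldType) (N d n : nat) (lo hi : 'I_N -> nat).
Hypotheses (lohi : forall t, (lo t < hi t)%N) (hi_lt : forall t, (hi t < n)%N).
Hypothesis lohi_inj : forall s t, lo s = lo t -> hi s = hi t -> s = t.
Local Notation Rvars := (n + n).+1.
Local Notation R := {mpoly k[Rvars]}.
Implicit Types (i j l h : nat) (s t : 'I_N) (m : 'X_{1..N}).

Definition vidx j : 'I_Rvars := inord j.
Definition widx j : 'I_Rvars := inord (n + j).

(* The entries of the columns once [w_0, ..., w_{i-1}] and [w_l] are killed; the
   variables [v_j] and [w_j] have indices [j] and [n + j]. *)
Definition wcol i l j : R := if (j < i)%N || (l <= j)%N then 0 else 'X_(widx j).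
Definition vcol i l j : R := if (j <= d)%N then 'X_(vidx j) else wcol i l j.-1.
Definition minor i l t : R :=
  vcol i l (lo t) * wcol i l (hi t) - vcol i l (hi t) * wcol i l (lo t).
Definition minors i l := [tuple minor i l t | t < N].

Lemma vidx_eq i j : (i < n)%N -> (j < n)%N -> (vidx i == vidx j) = (i == j).
Proof. by move=> hi_ hj; rewrite -val_eqE /= !inordK //; lia. Qed.

Lemma widx_eq i j : (i < n)%N -> (j < n)%N -> (widx i == widx j) = (i == j).
Proof. by move=> hi_ hj; rewrite -val_eqE /= !inordK //; lia. Qed.

Lemma vwidx_eq i j : (i < n)%N -> (j < n)%N -> (vidx i == widx j) = false.
Proof. by move=> hi_ hj; rewrite -val_eqE /= !inordK //; lia. Qed.

(** The leading monomials of the Plücker relations, then those of the Laplace relations. Columns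
    count from 0, whence [d < lo s]. The condition is not symmetric in [s] and [t]; [std] tests both
    orders. *)
Definition forbidden s t : bool :=
  [&& lo s < lo t, lo t < hi s & hi s < hi t]%N || (d < lo s)%N && (hi s <= lo t)%N.

Definition std m : bool :=
  [forall s, forall t, (0 < m s)%N && (0 < m t)%N ==> ~~ forbidden s t].

Lemma stdP m :
  reflect (forall s t, (0 < m s)%N -> (0 < m t)%N -> ~~ forbidden s t) (std m).
Proof.
apply: (iffP forallP) => [H s t ms mt|H s].
  by move/forallP/(_ t): (H s); rewrite ms mt.
by apply/forallP => t; apply/implyP => /andP[ms mt]; apply: H.
Qed.

(** * Injectivity of the initial term on the monomials of the last step *)

Section Leading.

Definition lmon t : 'X_{1..Rvars} :=
  (if (lo t <= d)%N then U_(vidx (lo t)) + U_(widx (hi t))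
   else U_(widx (lo t)) + U_(widx (hi t).-1))%MM.
Definition lead m : 'X_{1..Rvars} := (\sum_t lmon t *+ m t)%MM.

(* A superset of the monomials in the last step, closed under division. *)
Definition prechain m : Prop :=
  [/\ std m, forall t, (0 < m t)%N -> (lo t <= d)%N -> (d < hi t)%N &
      forall s t, (0 < m s)%N -> (0 < m t)%N ->
        (lo s <= d)%N -> (d < lo t)%N -> (hi s <= lo t)%N].

Lemma leadD m1 m2 : lead (m1 + m2)%MM = (lead m1 + lead m2)%MM.
Proof.
rewrite /lead -big_split /=; apply: eq_bigr => t _.
by apply/mnmP => x; rewrite !(mnmDE, mulmnE) mulnDr.
Qed.

Lemma lead_gt0 m x :
  reflect (exists2 t, (0 < m t)%N & (0 < lmon t x)%N) (0 < lead m x)%N.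
Proof.
have -> : lead m x = (\sum_t (lmon t x * m t))%N.
  by rewrite /lead mnm_sumE; apply: eq_bigr => t _; rewrite mulmnE.
rewrite lt0n sum_nat_eq0 negb_forall; apply: (iffP existsP) => [[t]|[t mt lt]].
  by rewrite /= muln_eq0 negb_or -!lt0n => /andP[]; exists t.
by exists t; rewrite /= muln_eq0 negb_or -!lt0n mt lt.
Qed.

Lemma lmonv t h : (h < n)%N ->
  (0 < lmon t (vidx h))%N = (lo t <= d)%N && (lo t == h).
Proof.
move=> hn; have := lohi t; have := hi_lt t => h1 h2.
rewrite /lmon; case: ifP => _; rewrite mnmDE !mnm1E.
  by rewrite vidx_eq ?[widx _ == _]eq_sym ?vwidx_eq //; lia.
by rewrite ![widx _ == _]eq_sym !vwidx_eq //; lia.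
Qed.

Lemma lmonw t j : (j < n)%N ->
  (0 < lmon t (widx j))%N =
  if (lo t <= d)%N then hi t == j else (lo t == j) || ((hi t).-1 == j).
Proof.
move=> hn; have := lohi t; have := hi_lt t => h1 h2.
by rewrite /lmon; case: ifP => _; rewrite mnmDE !mnm1E ?widx_eq ?vwidx_eq //; lia.
Qed.

(** Edges starting at or before [d] all end after [d] and do not cross, so they are nested: the
    latest start [h] and the earliest end belong to one edge. Edges starting after [d] contribute no
    smaller [w]-index, since they start where that edge ends or later. *)
Lemma prechain_edge m h j : (h < n)%N -> (j < n)%N -> prechain m ->
  (0 < lead m (vidx h))%N -> (forall h', (h' < n)%N -> (0 < lead m (vidx h'))%N -> h' <= h)%N ->
  (0 < lead m (widx j))%N -> (forall j', (j' < n)%N -> (0 < lead m (widx j'))%N -> j <= j')%N ->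
  exists2 t, (0 < m t)%N & lo t = h /\ hi t = j.
Proof.
move=> hn jn [/stdP sm pm cm] /lead_gt0[t mt]; rewrite lmonv // => /andP[td /eqP th] hmax.
move=> /lead_gt0[s ms]; rewrite lmonw // => sj jmin.
have jt : (j <= hi t)%N.
  by apply: jmin => //; apply/lead_gt0; exists t => //; rewrite lmonw // td.
have := pm _ mt td; have := lohi s; have := lohi t => h1 h2 h3.
move: sj; case: ifP => sd sj.
  have sh : (lo s <= h)%N.
    apply: hmax; first by move: (hi_lt s); lia.
    by apply/lead_gt0; exists s => //; rewrite lmonv ?sd ?eqxx //; move: (hi_lt s); lia.
  have := sm s t ms mt; have := pm _ ms sd; rewrite /forbidden => h4 h5.
  case: (eqVneq (lo s) h) => [e|ne]; first by exists s => //; split => //; lia.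
  by exists t => //; split => //; lia.
have := cm t s mt ms td; exists t => //; split => //; lia.
Qed.

(** Without [v]-variables all edges start after [d]. Two of them neither cross nor lie one after the
    other, so they are nested, and the outermost one has the extreme indices [i] and
    [j = hi - 1]. *)
Lemma chain_edge m i j : (i < n)%N -> (j < n)%N -> prechain m ->
  (forall h, (h < n)%N -> ~~ (0 < lead m (vidx h))%N) ->
  (0 < lead m (widx i))%N -> (forall j', (j' < n)%N -> (0 < lead m (widx j'))%N -> i <= j')%N ->
  (0 < lead m (widx j))%N -> (forall j', (j' < n)%N -> (0 < lead m (widx j'))%N -> j' <= j)%N ->
  exists2 t, (0 < m t)%N & lo t = i /\ hi t = j.+1.
Proof.
move=> hn jn [/stdP sm _ _] nov.
have chain t : (0 < m t)%N -> (lo t <= d)%N = false.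
  move=> mt; apply/negP => td.
  have tn : (lo t < n)%N by apply: ltn_trans (lohi t) (hi_lt t).
  move/negP: (nov _ tn); apply; apply/lead_gt0; exists t => //.
  by rewrite lmonv // td eqxx.
have leadw t x : (0 < m t)%N -> (x == lo t) || (x == (hi t).-1) -> (0 < lead m (widx x))%N.
  move=> mt xt; apply/lead_gt0; exists t => //.
  rewrite lmonw ?chain //; first by rewrite ![_ == x]eq_sym.
  by have := lohi t; have := hi_lt t; lia.
move=> /lead_gt0[s ms]; rewrite lmonw // chain // => si imin.
move=> /lead_gt0[t mt]; rewrite lmonw // chain // => tj jmax.
have lh x : (0 < m x)%N -> [/\ i <= lo x, (hi x).-1 <= j & lo x < hi x < n]%N.
  move=> mx; have := lohi x; have := hi_lt x => h1 h2; split.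
  - by apply: imin; [lia | apply: (leadw x); rewrite ?eqxx].
  - by apply: jmax; [lia | apply: (leadw x); rewrite ?eqxx ?orbT].
  - by lia.
have [s1 s2 s3] := lh _ ms; have [t1 t2 t3] := lh _ mt.
have := sm s t ms mt; have := chain _ ms; rewrite /forbidden => c1 c2.
case: (eqVneq (lo t) i) => [e|ne]; first by exists t => //; split => //; lia.
by exists s => //; split => //; lia.
Qed.

Lemma prechain_sub m t : prechain (U_(t) + m)%MM -> prechain m.
Proof.
have sup s : (0 < m s -> 0 < (U_(t) + m)%MM s)%N by rewrite mnmDE; lia.
case=> /stdP h1 h2 h3; split.
- by apply/stdP => s u /sup ms /sup mu; apply: h1.
- by move=> s /sup; apply: h2.
- by move=> s u /sup ms /sup mu; apply: h3.
Qed.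

Lemma mnm_subU m t : (0 < m t)%N -> exists m', m = (U_(t) + m')%MM.
Proof.
move=> mt; exists (m - U_(t))%MM; rewrite addmC submK //; apply/mnm_lepP => s.
by rewrite mnm1E; case: eqP => [<-|].
Qed.

(** Induction on the degree: by the two preceding lemmas the common value of [lead] names an edge
    present in both monomials, and this edge is divided out. *)
Lemma lead_inj m1 m2 : prechain m1 -> prechain m2 -> lead m1 = lead m2 -> m1 = m2.
Proof.
have [D] := ubnP (mdeg m1); elim: D m1 m2 => // D IH m1 m2 mD.
case: (pickP (fun t => 0 < m1 t)%N) => [t mt|m10]; last first.
  move=> _ _ e; suff m20 : forall t, m2 t = 0%N.
    by apply/mnmP => t; rewrite m20; move/negbT: (m10 t); rewrite -leqNgt leqn0 => /eqP.
  move=> t; apply/eqP; rewrite -leqn0 leqNgt; apply/negP => mt.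
  have : (0 < lead m2 (widx (if (lo t <= d)%N then hi t else lo t)))%N.
    apply/lead_gt0; exists t => //; rewrite lmonw; first by case: (lo t <= d)%N; rewrite /= eqxx.
    by case: ifP => _; rewrite ?hi_lt // (ltn_trans (lohi t)).
  rewrite -e => /lead_gt0[s]; by rewrite m10.
move=> p1 p2 e.
suff [u u1 u2] : exists2 u, (0 < m1 u)%N & (0 < m2 u)%N.
  have [m1' e1] := mnm_subU u1; have [m2' e2] := mnm_subU u2.
  rewrite e1 e2; congr (_ + _)%MM; apply: IH.
  - by move: mD; rewrite e1 mdegD mdeg1.
  - by apply: (@prechain_sub _ u); rewrite -e1.
  - by apply: (@prechain_sub _ u); rewrite -e2.
  - by move: e; rewrite e1 e2 !leadD => /addmI.
have exw : exists j, (j < n)%N && (0 < lead m1 (widx j))%N.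
  exists (if (lo t <= d)%N then hi t else lo t).
  have h : ((if (lo t <= d)%N then hi t else lo t) < n)%N.
    by case: ifP => _; rewrite ?hi_lt // (ltn_trans (lohi t)).
  rewrite h; apply/lead_gt0; exists t => //; rewrite lmonw //.
  by case: (lo t <= d)%N; rewrite /= eqxx.
have [j /andP[jn j1] jmin] := ex_minnP exw.
have {}jmin j' : (j' < n)%N -> (0 < lead m1 (widx j'))%N -> (j <= j')%N.
  by move=> h1 h2; apply: jmin; rewrite h1.
case: (pickP (fun h : 'I_n => 0 < lead m1 (vidx h))%N) => [h0 hh0|nov].
  have exh : exists h, (h < n)%N && (0 < lead m1 (vidx h))%N.
    by exists h0; rewrite ltn_ord.
  have ub h : (h < n)%N && (0 < lead m1 (vidx h))%N -> (h <= n)%N by lia.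
  have [h /andP[hn h1] hmax] := ex_maxnP exh ub.
  have {}hmax h' : (h' < n)%N -> (0 < lead m1 (vidx h'))%N -> (h' <= h)%N.
    by move=> ? ?; apply: hmax; apply/andP.
  have [u u1 [lu hu]] := prechain_edge hn jn p1 h1 hmax j1 jmin.
  rewrite e in h1 hmax j1 jmin.
  have [u' u2 [lu' hu']] := prechain_edge hn jn p2 h1 hmax j1 jmin.
  by exists u => //; rewrite (@lohi_inj u u') ?lu ?hu ?lu' ?hu'.
have {}nov h : (h < n)%N -> ~~ (0 < lead m1 (vidx h))%N.
  by move=> hn; rewrite (nov (Ordinal hn)).
have ub h : (h < n)%N && (0 < lead m1 (widx h))%N -> (h <= n)%N by lia.
have [l /andP[ln l1] lmax] := ex_maxnP exw ub.
have {}lmax h' : (h' < n)%N -> (0 < lead m1 (widx h'))%N -> (h' <= l)%N.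
  by move=> ? ?; apply: lmax; apply/andP.
have [u u1 [lu hu]] := chain_edge jn ln p1 nov j1 jmin l1 lmax.
rewrite e in nov j1 jmin l1 lmax.
have [u' u2 [lu' hu']] := chain_edge jn ln p2 nov j1 jmin l1 lmax.
by exists u => //; rewrite (@lohi_inj u u') ?lu ?hu ?lu' ?hu'.
Qed.

End Leading.

(* The monomials still present once [w_0, ..., w_{i-1}] are killed. *)
Definition wedge i l m : bool :=
  [&& std m, [forall t, (0 < m t)%N ==> (hi t <= l)%N],
      [exists t, (0 < m t)%N && (hi t == l)] &
      [forall t, (0 < m t)%N ==> (lo t < i)%N ==> (i <= hi t < l)%N]].

Lemma wedgeP i l m :
  reflect [/\ std m, forall t, (0 < m t)%N -> (hi t <= l)%N,
     exists2 t, (0 < m t)%N & hi t = l &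
     forall t, (0 < m t)%N -> (lo t < i)%N -> (i <= hi t < l)%N] (wedge i l m).
Proof.
apply: (iffP and4P) => [[h1 h2 /existsP[t /andP[mt /eqP tl]] h4]|[h1 h2 [t mt tl] h4]].
  split=> //; first by move=> s; apply/implyP; move/forallP: h2.
    by exists t.
  by move=> s ms si; apply: (implyP (implyP (forallP h4 s) ms) si).
split=> //; first by apply/forallP => s; apply/implyP/h2.
  by apply/existsP; exists t; rewrite mt tl eqxx.
by apply/forallP => s; apply/implyP => ms; apply/implyP/h4.
Qed.

(** The edge [a] at [l] must start after [d]. An edge [s] starting at or before [d] ends before [l],
    so, not crossing [a], it ends no later than [a] starts. An edge starting after [d] but before
    [a] must itself end at [l], and the same argument applies to it. *)
Lemma wedge_prechain l m : wedge d.+1 l m -> prechain m.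
Proof.
case/wedgeP => sm hl [a ma al] pre; split=> // [t mt td|s t ms mt sd td].
  by have := pre t mt; lia.
move/stdP: sm => sm.
have := pre _ ms; have := pre _ ma; have := lohi a; have := lohi s; have := lohi t.
have := hl _ ms; have := hl _ mt; have := sm _ _ ms mt; have := sm _ _ ms ma.
have := sm _ _ ma mt; have := sm _ _ mt ma; rewrite /forbidden; lia.
Qed.

(* The weight [j ^ 2] of [w_j] is strictly convex, so [w_i w_{j-1}] weighs less
   than the other term [w_{i-1} w_j] of the minor. *)
Definition sqw (x : 'I_Rvars) : nat := if (x < n)%N then 0%N else ((x - n) * (x - n))%N.

Lemma sqw_widx j : (j < n)%N -> sqw (widx j) = (j * j)%N.
Proof. by move=> jn; rewrite /sqw /= inordK ?ifN -?leqNgt ?addKn ?leq_addr //; lia. Qed.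

Lemma winitX w (u : 'X_{1..Rvars}) : winit w ('X_[u] : R) u.
Proof. by split=> [|m]; rewrite msuppX inE ?eqxx // => ->. Qed.

Lemma winit_subX w (p : R) (u : 'X_{1..Rvars}) :
  (forall v, v \in msupp p -> (wgt w u < wgt w v)%N) -> winit w (p - 'X_[u]) u.
Proof.
move=> h; split=> [|m].
  rewrite mcoeff_msupp mcoeffB mcoeffX eqxx memN_msupp_eq0 ?sub0r ?oppr_eq0 ?oner_eq0 //.
  by apply/negP => /h; rewrite ltnn.
move=> /msuppB_le; rewrite mem_cat msuppX inE => /orP[/h //|/eqP->].
by rewrite eqxx.
Qed.

(** If [lo t <= d], then [w_lo] is zero and a single monomial is left. Otherwise the minor is
    [w_{lo-1} w_hi - w_{hi-1} w_lo]; its second term survives, and the first is zero or heavier. *)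
Lemma winit_minor l t : (l < n)%N -> (hi t <= l)%N ->
  ((lo t <= d)%N -> (d < hi t < l)%N) ->
  winit sqw (minor d.+1 l t) (lmon t).
Proof.
move=> ln tl td; have lt_ := lohi t; rewrite /minor /lmon /vcol.
case: (leqP (lo t) d) td => [l1 /(_ isT)/andP[h1 h2]|l1 _].
  rewrite (_ : wcol _ _ (lo t) = 0) ?mulr0 ?subr0; last by rewrite /wcol ltnS l1.
  rewrite /wcol ifN; first by rewrite -mpolyXD; exact: winitX.
  by rewrite negb_or -leqNgt -ltnNge h1.
rewrite leqNgt (ltn_trans l1 lt_) /=.
have E j : (d < j < l)%N -> wcol d.+1 l j = 'X_(widx j).
  by move=> hj; rewrite /wcol ifN //; lia.
rewrite (E (lo t)) ?(E (hi t).-1); [|lia|lia].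
rewrite -mpolyXD addmC; apply: winit_subX => m.
rewrite /wcol; case: ifP => c1; rewrite ?mul0r ?msupp0 //.
case: ifP => c2; rewrite ?mulr0 ?msupp0 //.
rewrite -mpolyXD msuppX inE => /eqP->.
rewrite !wgtD !wgtU !sqw_widx; [nia|lia..].
Qed.

Lemma wedge_base l f : (l < n)%N ->
  (forall m, m \in msupp f -> wedge d.+1 l m) ->
  f \mPo minors d.+1 l = 0 -> f = 0 :> {mpoly k[N]}.
Proof.
move=> ln fK; apply: (@winit_indep _ _ _ sqw _ lead) => [m mf|m1 m2 m1f m2f].
  apply: winit_comp => t mt; rewrite tnth_mktuple.
  case/wedgeP: (fK _ mf) => _ hl _ pre; apply: winit_minor => // [|td]; first exact: hl.
  by have := pre _ mt; rewrite ltnS; apply.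
by apply: lead_inj; apply: (@wedge_prechain l); apply: fK.
Qed.

(** * Killing variables, and degrees in the generic columns *)

Definition kill (Z : pred 'I_Rvars) : Rvars.-tuple R :=
  [tuple if Z x then 0 else 'X_x | x < Rvars].

Lemma killX (Z : pred 'I_Rvars) x : 'X_x \mPo kill Z = if Z x then 0 else 'X_x.
Proof. by rewrite comp_mpolyXU -tnth_nth tnth_mktuple. Qed.

Lemma kill_wcol i l j : (l < n)%N -> (i < n)%N ->
  wcol i l j \mPo kill (pred1 (widx i)) = wcol i.+1 l j.
Proof.
move=> ln iN; rewrite /wcol ltnS; case: ifP => c1.
  by rewrite ifT ?comp_mpoly0 //; lia.
by rewrite killX /= widx_eq //; [congr (if _ then _ else _)|]; lia.
Qed.

Lemma kill_vcol i l j : (l < n)%N -> (i < n)%N -> (j < n)%N ->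
  vcol i l j \mPo kill (pred1 (widx i)) = vcol i.+1 l j.
Proof.
move=> ln iN jn; rewrite /vcol; case: ifP => _; last exact: kill_wcol.
by rewrite killX /= vwidx_eq.
Qed.

Lemma kill_minor i l t : (l < n)%N -> (i < n)%N ->
  minor i l t \mPo kill (pred1 (widx i)) = minor i.+1 l t.
Proof.
move=> ln iN; have := lohi t; have := hi_lt t => h1 h2.
rewrite /minor comp_mpolyB !rmorphM /= !kill_wcol ?kill_vcol //; lia.
Qed.

Definition cdeg h m : nat := wgt (fun t => (lo t == h) + (hi t == h))%N m.

(** Only columns before the Hankel block share no variable with another column, so only these
    degrees can be read off from the image. *)
Definition colhomog (f : {mpoly k[N]}) : Prop :=
  forall h, (h < d)%N -> {in msupp f &, forall m m', cdeg h m = cdeg h m'}.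

Lemma cdeg_gt0 h m :
  reflect (exists2 t, (0 < m t)%N & (lo t == h) || (hi t == h)) (0 < cdeg h m)%N.
Proof.
rewrite lt0n sum_nat_eq0 negb_forall; apply: (iffP existsP) => [[t]|[t mt lt]].
  by rewrite /= muln_eq0 negb_or -!lt0n => /andP[mt h1]; exists t => //; lia.
by exists t; rewrite /= muln_eq0 negb_or -!lt0n mt; lia.
Qed.

Lemma factor_edge (f : {mpoly k[N]}) i l t :
  (forall m, m \in msupp f -> (0 < m t)%N) -> minor i l t != 0 ->
  f \mPo minors i l = 0 -> colhomog f ->
  exists g, [/\ f = g * 'X_t, g \mPo minors i l = 0, colhomog g &
    forall m, m \in msupp g -> (U_(t) + m)%MM \in msupp f].
Proof.
move=> ft nz f0 hf; have [g e gf] := mpoly_divX ft; exists g; split=> //.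
- move: f0; rewrite e rmorphM /= comp_mpolyXU -tnth_nth tnth_mktuple => /eqP.
  by rewrite mulf_eq0 (negbTE nz) orbF => /eqP.
- move=> h hd m m'; rewrite !gf => m1 m2; have := hf h hd _ _ m1 m2.
  by rewrite /cdeg !wgtD => /addnI.
- by move=> m; rewrite gf.
Qed.

Lemma std_sub m t : std (U_(t) + m)%MM -> std m.
Proof.
move/stdP => h; apply/stdP => s u ms mu.
by apply: h; rewrite mnmDE; lia.
Qed.

Lemma vcol_neq0 i l j : (l < n)%N -> (j <= d)%N \/ (i < j <= l)%N -> vcol i l j != 0.
Proof.
move=> ln h; rewrite /vcol; case: ifP => jd; first by rewrite -msize_poly_eq0 msizeX.
by rewrite /wcol ifN -?msize_poly_eq0 ?msizeX //; lia.
Qed.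

Lemma wcol_neq0 i l j : (i <= j < l)%N -> wcol i l j != 0.
Proof. by move=> h; rewrite /wcol ifN -?msize_poly_eq0 ?msizeX //; lia. Qed.

Lemma wcol_eq0 i l j : (j < i)%N || (l <= j)%N -> wcol i l j = 0.
Proof. by rewrite /wcol => ->. Qed.

(** * Killing [w_0], ..., [w_d] one at a time *)

Section Descent.
Variables (l D : nat).
Hypothesis ln : (l < n)%N.
(** The induction hypothesis on the degree in [std_indep_homog]. It asks for no edge at [l], since
    division may remove the only one. *)
Hypothesis smaller_degree : forall f : {mpoly k[N]},
  (forall m, m \in msupp f ->
     [/\ std m, forall t, (0 < m t)%N -> (hi t <= l)%N & (mdeg m < D)%N]) ->
  colhomog f -> f \mPo minors 0 l = 0 -> f = 0.

Definition wedge_indep i M : Prop := forall f : {mpoly k[N]},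
  (forall m, m \in msupp f -> wedge i l m /\ (mdeg m < M)%N) ->
  colhomog f -> f \mPo minors i l = 0 -> f = 0.

Lemma wedge_step i M : (i <= d)%N -> (M <= D)%N ->
  wedge_indep i.+1 M.+1 -> wedge_indep i M -> wedge_indep i M.+1.
Proof.
move=> id MD IHi IHM f fK hf f0.
(* If [l <= i] there is no such monomial: its edge at [l] would start before [i] and hence have to
   end before [l]. *)
case: (leqP l i) => [li|il].
  apply: mpoly_supp0 => m; apply/negP => /fK[/wedgeP[_ _ [t mt tl] pre] _].
  by have := pre _ mt; have := lohi t; lia.
have iN : (i < n)%N by apply: ltn_trans ln.
have shape t m : (0 < m t)%N -> wedge i l m ->
    [/\ (lo t < i)%N -> (i <= hi t < l)%N, (hi t <= l)%N & (lo t < hi t)%N].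
  by move=> mt /wedgeP[_ h1 _ h2]; split; [exact: h2 | exact: h1 | exact: lohi].
(* The part of [f] that survives the killing of [w_i] is itself a relation at level [i.+1], hence
   zero by [IHi]. *)
have nK m : m \in msupp f -> ~~ wedge i.+1 l m.
  move=> mf; apply/negP => mK.
  suff e : mrestr (wedge i.+1 l) f = 0.
    by have := msupp_mrestr (wedge i.+1 l) f m; rewrite e msupp0 mf mK.
  apply: IHi.
  - by move=> u; rewrite msupp_mrestr => /andP[/fK[_ ?] ?].
  - move=> h hd u v; rewrite !msupp_mrestr => /andP[uf _] /andP[vf _].
    exact: hf.
  have step : f \mPo minors i.+1 l = 0.
    rewrite -(@comp_mpoly_comp _ _ _ _ _ (minors i l) (kill (pred1 (widx i)))).
      by rewrite f0 comp_mpoly0.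
    by move=> t; rewrite !tnth_mktuple kill_minor.
  rewrite comp_mrestr // => u uf /negP nu.
  have [uK _] := fK _ uf; have [sm hl lt pre] := wedgeP _ _ _ uK.
  case: (pickP (fun t => [&& 0 < u t, lo t < i.+1 & ~~ (i < hi t < l)]%N)) => [t|ex].
    case/and3P=> ut c1 c2; apply: (comp_mpolyX_eq0 ut); rewrite tnth_mktuple.
    have [s1 s2 s3] := shape _ _ ut uK.
    rewrite /minor (@wcol_eq0 _ _ (lo t)) ?mulr0 ?subr0; last by rewrite c1.
    by rewrite (@wcol_eq0 _ _ (hi t)) ?mulr0 //; lia.
  case: nu; apply/wedgeP; split=> // t ut ti.
  by move/negbT: (ex t); rewrite ut ti /= negbK.
have finish t : minor i l t != 0 -> (forall m, m \in msupp f -> (0 < m t)%N) ->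
    (forall g, (forall m, m \in msupp g -> (U_(t) + m)%MM \in msupp f) ->
       colhomog g -> g \mPo minors i l = 0 -> g = 0) -> f = 0.
  move=> nz ft hg; have [g [e g0 gh gs]] := factor_edge ft nz f0 hf.
  by rewrite e (hg g gs gh g0) mul0r.
(* So every monomial has an edge whose minor vanishes together with [w_i]. *)
have offends m : m \in msupp f -> exists2 t, (0 < m t)%N &
    (lo t < i)%N && (hi t == i) || (lo t == i) && (hi t == l).
  move=> mf; have [mK _] := fK _ mf; have [sm hl lt pre] := wedgeP _ _ _ mK.
  case: (pickP (fun t => [&& 0 < m t, lo t < i.+1 & ~~ (i < hi t < l)]%N)) => [t|ex].
    case/and3P=> mt c1 c2; exists t => //.
    by have [s1 s2 s3] := shape _ _ mt mK; lia.
  case/negP: (nK _ mf); apply/wedgeP; split=> // t mt ti.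
  by move/negbT: (ex t); rewrite mt ti /= negbK.
case: (boolP (has (fun m : 'X_{1..N} => [exists t, (0 < m t)%N && (lo t < i)%N])
    (msupp f))); last first.
  move=> /hasPn none; have {}none m t : m \in msupp f -> (0 < m t)%N -> (i <= lo t)%N.
    move=> mf mt; rewrite leqNgt; apply/negP => ti.
    by case/existsP: (none _ mf); exists t; rewrite mt ti.
  case: (posnP (size (msupp f))) => [/size0nil e|]; first by apply/eqP; rewrite -msupp_eq0 e.
  case E: (msupp f) => [//|m0 s] _.
  have m0f : m0 \in msupp f by rewrite E inE eqxx.
  have [t m0t tt] := offends _ m0f; have ti := none _ _ m0f m0t.
  (* The common edge is [(i, l)]; since [w_l = 0], its minor is [- v_l w_i]. *)
  apply: (finish t).
  - rewrite /minor (@wcol_eq0 _ _ (hi t)) ?mulr0 ?sub0r ?oppr_eq0; last by lia.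
    by rewrite mulf_neq0 ?wcol_neq0 ?vcol_neq0 //; have := lohi t; lia.
  - move=> m mf; have [s_ ms ss] := offends _ mf; have si := none _ _ mf ms.
    by rewrite (@lohi_inj t s_) //; lia.
  (* The quotient may have lost its edge at [l]. But all its edges start at [i] or later, where the
     columns are the same as with no [w_j] killed before [l], so the hypothesis for level 0
     applies. *)
  move=> g gs gh g0; apply: smaller_degree => // [m /gs mf|].
    have [mK md] := fK _ mf; have [sm hl _ _] := wedgeP _ _ _ mK; split.
    - exact: std_sub sm.
    - by move=> s_ ms; apply: hl; rewrite mnmDE; lia.
    - by move: md; rewrite mdegD mdeg1; lia.
  rewrite -g0; apply: eq_comp_mpoly => m s_ /gs mf ms; rewrite !tnth_mktuple.
  have {}si := none _ s_ mf; have {}ms : (0 < (U_(t) + m)%MM s_)%N by rewrite mnmDE; lia.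
  have {}si := si ms; have ls := lohi s_.
  have W j : (i <= j)%N -> wcol 0 l j = wcol i l j.
    by move=> ij; rewrite /wcol ltn0 ltnNge ij.
  have V j : (i <= j)%N -> vcol 0 l j = vcol i l j.
    by move=> ij; rewrite /vcol; case: leqP => // dj; rewrite W //; lia.
  by rewrite /minor !W ?V //; lia.
move=> /hasP[m0 m0f /existsP[s0 /andP[m0s0 s0i]]].
(* Let [h] be the last column before [i] where an edge of [m0] starts. As [h < i <= d], the column
   degrees make [h] the last such start in every monomial. *)
have exh : exists h, [exists t, [&& (0 < m0 t)%N, lo t == h & (lo t < i)%N]].
  by exists (lo s0); apply/existsP; exists s0; rewrite m0s0 eqxx s0i.
have ub h : [exists t, [&& (0 < m0 t)%N, lo t == h & (lo t < i)%N]] -> (h <= i)%N.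
  by case/existsP=> t /and3P[_ /eqP <-]; lia.
have [h /existsP[t0 /and3P[m0t0 /eqP t0h t0i]] hmax] := ex_maxnP exh ub.
have hd : (h < d)%N by lia.
have edge_h m : m \in msupp f -> exists2 t, (0 < m t)%N & lo t = h.
  move=> mf; have : (0 < cdeg h m0)%N by apply/cdeg_gt0; exists t0; rewrite // t0h eqxx.
  (* The edge found at [h] cannot end there: an edge starting before [i] ends at [i] or later. *)
  rewrite (hf h hd _ _ m0f mf) => /cdeg_gt0[t mt tt]; exists t => //.
  by have [mK _] := fK _ mf; have [] := shape _ _ mt mK; lia.
have below m t : m \in msupp f -> (0 < m t)%N -> (lo t < i)%N -> (lo t <= h)%N.
  move=> mf mt ti; have : (0 < cdeg (lo t) m)%N by apply/cdeg_gt0; exists t; rewrite ?eqxx.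
  have td : (lo t < d)%N by lia.
  rewrite (hf _ td _ _ mf m0f) => /cdeg_gt0[s_ ms ss]; apply: hmax.
  apply/existsP; exists s_; have [mK _] := fK _ m0f.
  by have [] := shape _ _ ms mK; rewrite ms; lia.
(* If the edge from [h] ended after [i], it would cross the offending edge, be it [(i, l)] or an
   edge ending at [i] that starts before [h]. *)
have common m : m \in msupp f -> exists2 t, (0 < m t)%N & lo t = h /\ hi t = i.
  move=> mf; have [t mt th] := edge_h _ mf; have [s_ ms ss] := offends _ mf.
  have [mK _] := fK _ mf; have [/stdP sm _ _ _] := wedgeP _ _ _ mK.
  have := sm t s_ mt ms; have := sm s_ t ms mt.
  have := below _ _ mf ms; have [a1 a2 a3] := shape _ _ mt mK.
  have [b1 b2 b3] := shape _ _ ms mK; rewrite /forbidden => c1 c2 c3.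
  case: (eqVneq (hi t) i) => [e|ne]; first by exists t.
  by exists s_ => //; split; lia.
have [t m0t [th ti]] := common _ m0f.
apply: (finish t).
- rewrite /minor (@wcol_eq0 _ _ (lo t)) ?mulr0 ?subr0; last by lia.
  by rewrite mulf_neq0 ?wcol_neq0 ?vcol_neq0 //; lia.
- by move=> m mf; have [s_ ms [sh si]] := common _ mf; rewrite (@lohi_inj t s_) //; lia.
(* Since [i < l], dividing by [(h, i)] leaves the edge at [l] in place, so the quotient stays at
   level [i]. *)
move=> g gs gh g0; apply: IHM => // m /gs mf.
have [mK md] := fK _ mf; have [sm hl [a ma al] pre] := wedgeP _ _ _ mK; split; last first.
  by move: md; rewrite mdegD mdeg1; lia.
have up s_ : (0 < m s_ -> 0 < (U_(t) + m)%MM s_)%N by rewrite mnmDE; lia.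
apply/wedgeP; split; first exact: std_sub sm.
- by move=> s_ /up; apply: hl.
- exists a => //; move: ma; rewrite mnmDE mnm1E.
  by case: eqP => [e|_] //; move: il; rewrite -ti e al ltnn.
- by move=> s_ /up; apply: pre.
Qed.

(** Induction on [d.+1 - i], starting from the distinct initial terms at level [d.+1], and within it
    on the degree bound. *)
Lemma wedge_indepP i M : (i <= d.+1)%N -> (M <= D.+1)%N -> wedge_indep i M.
Proof.
move=> id; have [c ec] : exists c, (i + c = d.+1)%N by exists (d.+1 - i)%N; rewrite subnKC.
elim: c i M id ec => [|c IHc] i M id ec MD.
  move=> f fK _ f0; rewrite addn0 in ec; rewrite ec in fK f0.
  by apply: (wedge_base ln) f0 => m /fK[].
elim: M MD => [|M IHM] MD.
  by move=> f fK _ _; apply: mpoly_supp0 => m; apply/negP => /fK[].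
apply: wedge_step => //; [lia| |by apply: IHM; lia].
by apply: IHc => //; lia.
Qed.

End Descent.

(** * Truncation of the matrix and reduction to the column-homogeneous case *)

Hypothesis dn : (d <= n)%N.

(** For [l > d] the entry [v_l] is [w_{l-1}], for [l <= d] it is a variable of its own; killing both
    covers the two cases. As [w_l] is already zero, column [l] vanishes, and [w_{l-1} = 0] is the
    normalization of the shorter matrix. *)
Lemma kill_last l t : (0 < l)%N -> (l < n)%N -> (hi t <= l)%N ->
  minor 0 l t \mPo kill (pred2 (widx l.-1) (vidx l)) =
  if (hi t < l)%N then minor 0 l.-1 t else 0.
Proof.
move=> l0 ln tl; have lt_ := lohi t; set Z := pred2 _ _.
have W j : (j < n)%N -> wcol 0 l j \mPo kill Z = wcol 0 l.-1 j.
  move=> jn; rewrite /wcol /=; case: leqP => c; first by rewrite comp_mpoly0 ifT //; lia.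
  rewrite killX /= widx_eq //; last by lia.
  rewrite [widx _ == vidx _]eq_sym vwidx_eq // orbF.
  by congr (if _ then _ else _); lia.
have V j : (j < l)%N -> vcol 0 l j \mPo kill Z = vcol 0 l.-1 j.
  move=> jl; rewrite /vcol; case: ifP => _; last by apply: W; lia.
  by rewrite killX /= vwidx_eq ?vidx_eq ?ifN //; lia.
rewrite /minor comp_mpolyB !rmorphM /=.
case: ltnP => hl; first by rewrite !W ?V //; lia.
have e : hi t = l by lia.
rewrite !W ?e //; last by lia.
rewrite (@wcol_eq0 _ _ l) ?mulr0 ?sub0r; last by lia.
suff -> : vcol 0 l l \mPo kill Z = 0 by rewrite mul0r oppr0.
rewrite /vcol; case: ifP => _; first by rewrite killX /= eqxx orbT.
by rewrite W ?wcol_eq0 //; lia.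
Qed.

Lemma std_indep_homog l D f : (l < n)%N ->
  (forall m, m \in msupp f ->
     [/\ std m, forall t, (0 < m t)%N -> (hi t <= l)%N & (mdeg m < D)%N]) ->
  colhomog f -> f \mPo minors 0 l = 0 -> f = 0.
Proof.
elim: l D f => [|l IHl] D f ln fK hf f0.
  (* With [l = 0] no edge fits, so [f] is a constant and any weight serves. *)
  have no m t : m \in msupp f -> (0 < m t)%N = false.
    by move=> /fK[_ h _]; apply/negP => /h; have := lohi t; lia.
  apply: (@winit_indep _ _ _ (fun=> 0%N) _ lead f) f0 => [m mf|m1 m2 m1f m2f].
    by apply: winit_comp => t; rewrite no.
  apply: lead_inj; split.
  - by case: (fK _ m1f).
  - by move=> t; rewrite no.
  - by move=> s t; rewrite no.
  - by case: (fK _ m2f).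
  - by move=> t; rewrite no.
  - by move=> s t; rewrite no.
elim: D f fK hf f0 => [|D IHD] f fK hf f0.
  by apply: mpoly_supp0 => m; apply/negP => /fK[].
(* At level 0 the condition on edges starting before [i] is empty; what is left to show is that each
   monomial has an edge at [l.+1]. The monomials without one are those that survive the truncation,
   and they vanish by [IHl]. *)
apply: (@wedge_indepP l.+1 D ln IHD 0 D.+1) => // m mf.
have [sm hl md] := fK _ mf; split=> //.
pose Q (u : 'X_{1..N}) := [forall t, (0 < u t)%N ==> (hi t <= l)%N].
have r0 : mrestr Q f = 0.
  apply: (IHl D.+1); first by lia.
  - move=> u; rewrite msupp_mrestr => /andP[/fK[? ? ?] /forallP Qu].
    by split=> // t; apply/implyP.
  - move=> h hd u v; rewrite !msupp_mrestr => /andP[uf _] /andP[vf _].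
    exact: hf.
  set Z := kill (pred2 (widx l) (vidx l.+1)).
  pose ls := [tuple minor 0 l.+1 t \mPo Z | t < N].
  have E t : (hi t <= l.+1)%N -> tnth ls t = if (hi t <= l)%N then minor 0 l t else 0.
    by move=> ht; rewrite tnth_mktuple (@kill_last l.+1).
  have <- : mrestr Q f \mPo ls = mrestr Q f \mPo minors 0 l.
    apply: eq_comp_mpoly => u t; rewrite msupp_mrestr => /andP[_ /forallP Qu] ut.
    by have {}Qu := implyP (Qu t) ut; rewrite E ?Qu ?tnth_mktuple //; lia.
  rewrite comp_mrestr => [|u uf]; last first.
    rewrite negb_forall => /existsP[t]; rewrite negb_imply => /andP[ut tl].
    apply: (comp_mpolyX_eq0 ut); rewrite E ?(negbTE tl) //.
    by have [_ h _] := fK _ uf; apply: h.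
  rewrite -(@comp_mpoly_comp _ _ _ _ _ (minors 0 l.+1) Z) ?f0 ?comp_mpoly0 // => t.
  by rewrite !tnth_mktuple.
apply/wedgeP; split=> //.
have := msupp_mrestr Q f m; rewrite r0 msupp0 mf => /esym/negbT.
rewrite negb_forall => /existsP[t]; rewrite negb_imply => /andP[mt tl].
by exists t => //; have := hl _ mt; lia.
Qed.

Lemma wcol_whomog h l j : (h < n)%N -> (l < n)%N ->
  whomog (fun x => (x == vidx h) + (x == widx h))%N (j == h) (wcol 0 l j).
Proof.
move=> hn ln; rewrite /wcol; case: ifP => c; first exact: whomog0.
move=> v /whomogX ->; rewrite wgtU [_ == vidx h]eq_sym vwidx_eq ?widx_eq //; lia.
Qed.

Lemma minor_whomog h l t : (h < d)%N -> (l < n)%N ->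
  whomog (fun x => (x == vidx h) + (x == widx h))%N ((lo t == h) + (hi t == h))
    (minor 0 l t).
Proof.
move=> hd ln; have hn : (h < n)%N by lia.
have V j : (j < n)%N ->
    whomog (fun x => (x == vidx h) + (x == widx h))%N (j == h) (vcol 0 l j).
  move=> jn; rewrite /vcol; case: leqP => jd.
    by move=> v /whomogX ->; rewrite wgtU vidx_eq ?vwidx_eq ?addn0.
  (* Both sides are false, because [h < d < j]: the later columns do not involve the variables of
     column [h]. *)
  by rewrite (_ : (j == h) = (j.-1 == h)); [exact: wcol_whomog | lia].
have := lohi t; have := hi_lt t => h1 h2.
apply: whomogB; last rewrite addnC; apply: whomogM;
  by [apply: V; lia | apply: wcol_whomog].
Qed.

(** Images of monomials are homogeneous in the variables of each generic column, so the part of [f]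
    with the column degrees of a given [m0] is again a relation. *)
Lemma std_indep l f : (l < n)%N ->
  (forall m, m \in msupp f -> std m /\ forall t, (0 < m t)%N -> (hi t <= l)%N) ->
  f \mPo minors 0 l = 0 -> f = 0.
Proof.
move=> ln fK f0; apply: mpoly_supp0 => m0; apply/negP => m0f.
pose Q m := [forall h : 'I_d, cdeg h m == cdeg h m0].
suff r0 : mrestr Q f = 0.
  have := msupp_mrestr Q f m0; rewrite r0 msupp0 m0f /= => /esym/negP; apply.
  exact/forallP.
have QP m h : Q m -> (h < d)%N -> cdeg h m = cdeg h m0.
  by move=> /forallP Qm hd; apply/eqP; apply: (Qm (Ordinal hd)).
apply: (@std_indep_homog l (msize f)) => // [m|h hd m m'|].
- rewrite msupp_mrestr => /andP[mf _]; have [sm hl] := fK _ mf.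
  by split=> //; apply: msize_mdeg_lt.
- by rewrite !msupp_mrestr => /andP[_ /QP->] // /andP[_ /QP->].
apply/mpolyP => v; rewrite mcoeff0.
pose w h x := ((x == vidx h) + (x == widx h))%N.
have hom m h : (h < d)%N -> v \in msupp ('X_[m] \mPo minors 0 l) -> wgt (w h) v = cdeg h m.
  move=> hd; apply: whomog_comp => t; rewrite tnth_mktuple.
  exact: minor_whomog.
(* If [v] has the column degrees of [m0], only monomials in [Q] contribute to its coefficient, which
   is thus that of the image of [f]; otherwise no monomial in [Q] contributes. *)
have [b|nb] := boolP [forall h : 'I_d, wgt (w h) v == cdeg h m0]; last first.
  rewrite /mrestr (raddf_sum (comp_mpoly (minors 0 l))) raddf_sum /= big1_seq // => m /andP[Qm mf].
  rewrite comp_mpolyZ mcoeffZ [X in _ * X]memN_msupp_eq0 ?mulr0 //.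
  apply: contra nb => vm; apply/forallP => h.
  by rewrite (hom m) // (QP m).
rewrite -(mcoeff0 k v) -f0 (comp_mpolyEX f) /mrestr.
rewrite (raddf_sum (comp_mpoly (minors 0 l))) !raddf_sum /= big_mkcond.
apply: eq_big_seq => m mf; case: ifPn => Qm; first by rewrite comp_mpolyZ.
rewrite mcoeffZ [X in _ * X]memN_msupp_eq0 ?mulr0 //.
apply: contra Qm => vm; apply/forallP => h.
by rewrite -(hom m) //; exact: (forallP b).
Qed.

End Independence.

(** * Leading monomials of the relations *)

Section Ideals.
Variables (k : fieldType) (N : nat).
Implicit Types (A B : {mpoly k[N]} -> Prop) (p q : {mpoly k[N]}).

Lemma ideal_gen_incl A p : A p -> ideal_gen A p.
Proof.
move=> Ap; exists [:: (1, p)]; split=> [u|]; last by rewrite big_seq1 mul1r.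
by rewrite inE => /eqP->.
Qed.

Lemma ideal_genD A p q : ideal_gen A p -> ideal_gen A q -> ideal_gen A (p + q).
Proof.
move=> [s [hs ->]] [r [hr ->]]; exists (s ++ r); rewrite big_cat; split=> // u.
by rewrite mem_cat => /orP[/hs|/hr].
Qed.

Lemma ideal_genM A p q : ideal_gen A q -> ideal_gen A (p * q).
Proof.
move=> [s [hs ->]]; exists [seq (p * u.1, u.2) | u <- s]; split=> [u|].
  by case/mapP=> x xs ->; exact: (hs x xs).
by rewrite mulr_sumr big_map; apply: eq_bigr => u _; rewrite mulrA.
Qed.

Lemma ideal_gen_sub A B p :
  (forall q, A q -> ideal_gen B q) -> ideal_gen A p -> ideal_gen B p.
Proof.
move=> AB [s [hs ->]]; elim: s hs => [|u s IH] hs.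
  by exists [::]; rewrite !big_nil; split.
rewrite big_cons; apply: ideal_genD.
  by apply: ideal_genM; apply: AB; apply: hs; rewrite inE eqxx.
by apply: IH => v vs; apply: hs; rewrite inE vs orbT.
Qed.

End Ideals.

(** * The monomial order on products of two edges *)

Section PluckerLead.
Variables (k : fieldType) (n : nat).
Local Notation P := {mpoly k[nvars n]}.
Local Notation mon := 'X_{1..nvars n}.
Implicit Types (p q r : colpair n) (a b c g i j : 'I_n).

Definition edge2 p q : mon := (U_(enum_rank p) + U_(enum_rank q))%MM.

Lemma exponentU p r : exponent U_(enum_rank p)%MM r = (p == r).
Proof. by rewrite /exponent mnm1E (inj_eq enum_rank_inj). Qed.

Lemma multideg1U p i :
  multideg1 U_(enum_rank p)%MM i = (((val p).1 == i) + ((val p).2 == i))%N.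
Proof.
rewrite /multideg1 mnm_sumE (bigD1 p) //= exponentU eqxx mulmnE mnmDE !mnm1E muln1.
rewrite big1 ?addn0 // => r rp.
by rewrite exponentU eq_sym (negbTE rp) mulmnE muln0.
Qed.

Lemma multideg2U p i : multideg2 U_(enum_rank p)%MM i = ((val p).1 == i).
Proof.
rewrite /multideg2 mnm_sumE (bigD1 p) //= exponentU eqxx mulmnE !mnm1E muln1.
rewrite big1 ?addn0 // => r rp.
by rewrite exponentU eq_sym (negbTE rp) mulmnE muln0.
Qed.

Lemma mdeg_edge2 p q : mdeg (edge2 p q) = 2%N.
Proof. by rewrite mdegD !mdeg1. Qed.

Lemma mdeg_multideg2 (m : mon) : mdeg (multideg2 m) = mdeg m.
Proof.
rewrite /multideg2 mdeg_sum mdegE.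
rewrite (reindex (@enum_rank (colpair n))) /=; last exact/onW_bij/enum_rank_bij.
by apply: eq_bigr => p _; rewrite mdegMn mdeg1 mul1n.
Qed.

(** The first column is the least variable here, so the first column where the multidegrees differ
    decides, and the larger exponent gives the smaller monomial. *)
Lemma plucker_lt_deg1 (m1 m2 : mon) i : mdeg m1 = mdeg m2 ->
  (multideg1 m2 i < multideg1 m1 i)%N ->
  (forall j, (j < i)%N -> multideg1 m2 j = multideg1 m1 j) ->
  plucker_lt m1 m2.
Proof.
move=> md hi hj; apply/orP; left; rewrite /grevlex_lt -!mdegE !mdeg_multideg1 md ltnn eqxx /=.
by apply/existsP; exists i; rewrite hi; apply/forallP => j; apply/implyP => /hj ->.
Qed.

(** For the second multidegree the last column is the least variable, so the last difference
    decides. *)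
Lemma plucker_lt_deg2 (m1 m2 : mon) i : multideg1 m1 = multideg1 m2 ->
  (multideg2 m2 i < multideg2 m1 i)%N ->
  (forall j, (i < j)%N -> multideg2 m2 j = multideg2 m1 j) ->
  plucker_lt m1 m2.
Proof.
move=> e1 hi hj; apply/orP; right; rewrite e1 eqxx /=.
have md : mdeg m1 = mdeg m2.
  by have := mdeg_multideg1 m1; rewrite e1 mdeg_multideg1; lia.
apply/orP; left; rewrite /grevlex_lt -!mdegE !mdeg_multideg2 md ltnn eqxx /=.
by apply/existsP; exists i; rewrite hi; apply/forallP => j; apply/implyP => /hj ->.
Qed.

Lemma plucker_lt_lex (m1 m2 : mon) p :
  multideg1 m1 = multideg1 m2 -> multideg2 m1 = multideg2 m2 ->
  (exponent m1 p < exponent m2 p)%N ->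
  (forall q, colpair_gt q p -> exponent m1 q = exponent m2 q) ->
  plucker_lt m1 m2.
Proof.
move=> e1 e2 hp hq; apply/orP; right; rewrite e1 e2 !eqxx /=.
apply/orP; right.
by apply/existsP; exists p; rewrite hp; apply/forallP => q; apply/implyP => /hq ->.
Qed.

(** The order refines the degree, so only finitely many monomials lie below a given one; this makes
    reduction terminate. *)
Lemma plucker_lt_mdeg (m1 m2 : mon) : plucker_lt m1 m2 -> (mdeg m1 <= mdeg m2)%N.
Proof.
suff : (mdeg (multideg1 m1) <= mdeg (multideg1 m2))%N -> (mdeg m1 <= mdeg m2)%N.
  move=> h lt; apply: h; move: lt; rewrite /plucker_lt /grevlex_lt -!mdegE.
  by case/orP => [/orP[/ltnW //|/andP[/eqP-> //]]|/andP[/eqP-> //]].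
by rewrite !mdeg_multideg1 leq_pmul2r.
Qed.

Definition below (u : mon) (f : P) : Prop := forall m, m \in msupp f -> plucker_lt m u.

Lemma belowD u f h : below u f -> below u h -> below u (f + h).
Proof. by move=> hf hg m /msuppD_le; rewrite mem_cat => /orP[/hf|/hg]. Qed.

Lemma belowN u f : below u f -> below u (- f).
Proof. by move=> hf m; rewrite (perm_mem (msuppN _)) => /hf. Qed.

Lemma belowX u m : plucker_lt m u -> below u 'X_[m].
Proof. by move=> h v; rewrite msuppX inE => /eqP->. Qed.

Definition leads (f : P) (u : mon) : Prop :=
  exists (x : k) (h : P), [/\ x != 0, f = x *: 'X_[u] + h & below u h].

Lemma leads_lead_monomial f u :
  leads f u -> is_lead_monomial (plucker_order n) f u.
Proof.
case=> c [r [c0 -> br]].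
have ru : r@_u = 0.
  by apply: memN_msupp_eq0; apply/negP => /br; rewrite plucker_lt_irr.
split; first by rewrite mcoeff_msupp mcoeffD mcoeffZ mcoeffX eqxx mulr1 ru addr0.
move=> m /msuppD_le; rewrite mem_cat => /orP[/msuppZ_le|/br h].
  by rewrite msuppX inE => /eqP->; rewrite /= /plucker_le eqxx.
by rewrite /= /plucker_le h orbT.
Qed.

Lemma lead_monomial_leads f u :
  is_lead_monomial (plucker_order n) f u -> leads f u.
Proof.
move=> [uf h]; exists f@_u, (f - f@_u *: 'X_[u]); split.
- by rewrite -mcoeff_msupp.
- by rewrite addrC subrK.
move=> m; rewrite (perm_mem (msupp_rem _ _)) mem_rem_uniq ?msupp_uniq // !inE.
by case/andP=> ne /h /orP[/eqP e|//]; rewrite e eqxx in ne.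
Qed.

Lemma multideg1_edge2 p q i : multideg1 (edge2 p q) i =
  ((((val p).1 == i) + ((val p).2 == i)) + (((val q).1 == i) + ((val q).2 == i)))%N.
Proof. by rewrite /edge2 multideg1D mnmDE !multideg1U. Qed.

Lemma multideg2_edge2 p q i :
  multideg2 (edge2 p q) i = (((val p).1 == i) + ((val q).1 == i))%N.
Proof. by rewrite /edge2 multideg2D mnmDE !multideg2U. Qed.

Lemma exponent_edge2 p q r : exponent (edge2 p q) r = ((p == r) + (q == r))%N.
Proof. by rewrite exponentD !exponentU. Qed.

End PluckerLead.

(** * Leading monomials of the Plücker and Laplace relations *)

Section RelationLead.
Variables (k : fieldType) (d e : nat).
Local Notation n := (d + e)%N.
Implicit Types (p q r : colpair n) (a b c g i j : 'I_n).

Lemma TvarE p : Tvar k (val p).1 (val p).2 = 'X_(enum_rank p).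
Proof.
rewrite /Tvar; case: insubP => [q _ eq|]; last by rewrite -surjective_pairing (valP p).
by congr 'X_(enum_rank _); apply: val_inj; rewrite eq -surjective_pairing.
Qed.

Definition cpair a b (ab : (a < b)%N) : colpair n := Sub (a, b) ab.

Lemma Tvar_lt a b (ab : (a < b)%N) : Tvar k a b = 'X_(enum_rank (cpair ab)).
Proof. exact: (TvarE (cpair ab)). Qed.

Lemma TvarM a b c g (ab : (a < b)%N) (cg : (c < g)%N) :
  Tvar k a b * Tvar k c g = 'X_[edge2 (cpair ab) (cpair cg)].
Proof. by rewrite !Tvar_lt -mpolyXD. Qed.

(** The three terms share the first multidegree. The second puts [T_{a,b} T_{c,g}] lower because of
    its start at [c], and the lexicographic rule prefers [T_{a,c}] to [T_{a,g}]. *)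
Lemma PLU_leads a b c g (ac : (a < c)%N) (bg : (b < g)%N) :
  (a < b < c)%N -> (c < g)%N -> leads (PLU k a b c g) (edge2 (cpair ac) (cpair bg)).
Proof.
move=> abc cg.
have ab : (a < b)%N by lia. have bc : (b < c)%N by lia. have ag : (a < g)%N by lia.
exists (-1), (Tvar k a b * Tvar k c g + Tvar k a g * Tvar k b c); split.
- by rewrite oppr_eq0 oner_eq0.
- by rewrite scaleN1r -TvarM /PLU; ring.
apply: belowD; rewrite ?(TvarM ab cg) ?(TvarM ag bc); apply: belowX.
  apply: (@plucker_lt_deg2 _ _ _ c).
  - by apply/mnmP => i; rewrite !multideg1_edge2 /=; lia.
  - by rewrite !multideg2_edge2 /= -!val_eqE /=; lia.
  - by move=> j cj; rewrite !multideg2_edge2 /= -!val_eqE /=; lia.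
apply: (@plucker_lt_lex _ _ _ (cpair ac)).
- by apply/mnmP => i; rewrite !multideg1_edge2 /=; lia.
- by apply/mnmP => i; rewrite !multideg2_edge2 /=; lia.
- rewrite !exponent_edge2 -!val_eqE /= !xpair_eqE -!val_eqE /=; lia.
- move=> q; rewrite /colpair_gt /= !exponent_edge2 -!val_eqE /=.
  by case: (val q) => q1 q2; rewrite !xpair_eqE -!val_eqE /=; lia.
Qed.

Lemma ordS_lt a : (a.+1 < n)%N -> ordS a = a.+1 :> nat.
Proof. by move=> h; rewrite /= modn_small. Qed.

Lemma below_TvarM a b c g p q i : (a < b)%N -> (c < g)%N ->
  (multideg1 (edge2 p q) i < (a == i) + (b == i) + ((c == i) + (g == i)))%N ->
  (forall j, (j < i)%N ->
     multideg1 (edge2 p q) j = (a == j) + (b == j) + ((c == j) + (g == j))%N)%N ->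
  below (edge2 p q) (Tvar k a b * Tvar k c g).
Proof.
move=> ab cg hi hj; rewrite (TvarM ab cg); apply: belowX.
apply: (@plucker_lt_deg1 _ _ _ i); rewrite ?mdeg_edge2 //.
  by rewrite [X in (_ < X)%N]multideg1_edge2.
by move=> j /hj ->; rewrite multideg1_edge2.
Qed.

Lemma ord_eqE i j : (i == j) = (i == j :> nat).
Proof. by []. Qed.

Lemma below_first a b c g p q : (a < b)%N -> (c < g)%N -> (a < c)%N ->
  (a < (val p).1)%N -> (a < (val q).1)%N ->
  below (edge2 p q) (Tvar k a b * Tvar k c g).
Proof.
move=> ab cg ac ap aq.
have hp : ((val p).1 < (val p).2)%N := valP p.
have hq : ((val q).1 < (val q).2)%N := valP q.
apply: (@below_TvarM _ _ _ _ _ _ a) => [|||j ja] //;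
  rewrite multideg1_edge2 !ord_eqE; lia.
Qed.

(** Up to column [a] the two products differ only at [a], which occurs once more in
    [T_{a,b} T_{c,g}]; column [c] is shared with [p]. *)
Lemma below_second a b c g p q : (a < b)%N -> (c < g)%N ->
  (c <= a)%N -> (a < g)%N -> (val p).1 = c :> nat -> (a < (val p).2)%N -> (a < (val q).1)%N ->
  below (edge2 p q) (Tvar k a b * Tvar k c g).
Proof.
move=> ab cg ca ag ep ap aq.
have hq : ((val q).1 < (val q).2)%N := valP q.
apply: (@below_TvarM _ _ _ _ _ _ a) => [|||j ja] //;
  rewrite multideg1_edge2 !ord_eqE; lia.
Qed.

Lemma leads_edge2 p q f :
  below (edge2 p q) (f - Tvar k (val p).1 (val p).2 * Tvar k (val q).1 (val q).2) ->
  leads f (edge2 p q).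
Proof.
move=> h; exists 1; eexists; split; [exact: oner_neq0 | | exact: h].
by rewrite scale1r !TvarE -mpolyXD addrC subrK.
Qed.

(** The first multidegree decides: three terms contain column [a], absent from
    [T_{a+1,b+1} T_{c,g}], and the two others contain column [b] once more than it does. *)
Lemma LAP_leads a b c g p q :
  (a < b < c)%N -> (c < g)%N -> (g.+1 < n)%N ->
  (val p).1 = ordS a -> (val p).2 = ordS b -> (val q).1 = c -> (val q).2 = g ->
  leads (LAP k a b c g) (edge2 p q).
Proof.
move=> abc cg gn p1 p2 q1 q2; apply: leads_edge2.
have [sa sb sc sg] : [/\ ordS a = a.+1 :> nat, ordS b = b.+1 :> nat,
    ordS c = c.+1 :> nat & ordS g = g.+1 :> nat] by split; apply: ordS_lt; lia.
have -> : LAP k a b c g - Tvar k (val p).1 (val p).2 * Tvar k (val q).1 (val q).2 =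
  Tvar k a b * Tvar k (ordS c) (ordS g) - Tvar k a c * Tvar k (ordS b) (ordS g)
  + Tvar k a g * Tvar k (ordS b) (ordS c) + Tvar k b c * Tvar k (ordS a) (ordS g)
  - Tvar k b g * Tvar k (ordS a) (ordS c) by rewrite p1 p2 q1 q2 /LAP; ring.
repeat first [apply: belowD | apply: belowN];
  by [apply: below_first; rewrite ?p1 ?p2 ?q1 ?q2 ?sa ?sb ?sc ?sg; lia
     |apply: below_second; rewrite ?p1 ?p2 ?q1 ?q2 ?sa ?sb ?sc ?sg; lia].
Qed.

Lemma LAP_last_leads a b c g p q :
  (a < b < c)%N -> (c < g)%N ->
  (val p).1 = ordS a -> (val p).2 = ordS b -> (val q).1 = c -> (val q).2 = g ->
  leads (LAP_last k a b c g) (edge2 p q).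
Proof.
move=> abc cg p1 p2 q1 q2; apply: leads_edge2; have gn := ltn_ord g.
have [sa sb sc] : [/\ ordS a = a.+1 :> nat, ordS b = b.+1 :> nat &
    ordS c = c.+1 :> nat] by split; apply: ordS_lt; lia.
have -> : LAP_last k a b c g - Tvar k (val p).1 (val p).2 * Tvar k (val q).1 (val q).2 =
  Tvar k a g * Tvar k (ordS b) (ordS c) - Tvar k b g * Tvar k (ordS a) (ordS c)
  by rewrite p1 p2 q1 q2 /LAP_last; ring.
repeat first [apply: belowD | apply: belowN];
  by [apply: below_first; rewrite ?p1 ?p2 ?q1 ?q2 ?sa ?sb ?sc; lia
     |apply: below_second; rewrite ?p1 ?p2 ?q1 ?q2 ?sa ?sb ?sc; lia].
Qed.

Definition colmin p := nat_of_ord (val p).1.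
Definition colmax p := nat_of_ord (val p).2.
Definition edge_lo (t : 'I_(nvars n)) := colmin (enum_val t).
Definition edge_hi (t : 'I_(nvars n)) := colmax (enum_val t).

Lemma forbidden_leads (s t : 'I_(nvars n)) : forbidden d edge_lo edge_hi s t ->
  exists2 f, @plucker_laplace k d e f & leads f (U_(s) + U_(t))%MM.
Proof.
rewrite -[s]enum_valK -[t]enum_valK -/(edge2 _ _) /edge_lo /edge_hi /forbidden !enum_rankK.
move: (enum_val s : colpair n) (enum_val t : colpair n) => p q {s t}; rewrite /colmin /colmax.
have hp : ((val p).1 < (val p).2)%N := valP p.
have hq : ((val q).1 < (val q).2)%N := valP q.
case: (boolP [&& _, _ & _]) => [/and3P[h1 h2 h3] _|_ /andP[dp pq]].
  exists (PLU k (val p).1 (val q).1 (val p).2 (val q).2).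
    by left; exists (val p).1, (val q).1, (val p).2, (val q).2; rewrite h1 h2 h3.
  suff -> : edge2 p q = edge2 (cpair hp) (cpair hq) by apply: PLU_leads; rewrite ?h1 ?h2.
  by congr edge2; apply: val_inj; rewrite /= -surjective_pairing.
have {}dp : (d < (val p).1)%N := dp; have {}pq : ((val p).2 <= (val q).1)%N := pq.
have pn := ltn_ord (val p).1; have qn := ltn_ord (val q).2.
(* The predecessor of column 0 is a dummy value; [prev] is applied only to columns after [d]. *)
pose prev (x : 'I_n) := Ordinal (leq_ltn_trans (leq_pred x) (ltn_ord x)).
have prevK (x : 'I_n) : (0 < x)%N -> ordS (prev x) = x.
  move=> x0; apply: val_inj; rewrite /= prednK // modn_small //; exact: ltn_ord.
(* The leading monomial contains the shifted pair [(a+1, b+1)], so [p] is shifted back; [d < lo p]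
   becomes [d <= a]. *)
pose a := prev (val p).1; pose b := prev (val p).2.
have ea : ordS a = (val p).1 by apply: prevK; lia.
have eb : ordS b = (val p).2 by apply: prevK; lia.
have [va vb] : (a = (val p).1.-1 :> nat) * (b = (val p).2.-1 :> nat) by [].
have abc : (a < b < (val q).1)%N by lia.
case: (ltngtP (val q).2.+1 n) => gn; last 2 first.
- by move: qn; rewrite ltnNge -ltnS gn.
- exists (LAP_last k a b (val q).1 (val q).2); last by apply: LAP_last_leads.
  right; exists a, b, (val q).1, (val q).2; split=> //; [lia | by right].
exists (LAP k a b (val q).1 (val q).2); last by apply: LAP_leads.
by right; exists a, b, (val q).1, (val q).2; split=> //; [lia | left].
Qed.

End RelationLead.

(** * The relations and the standard monomials under [pi_F] *)

Section Kernel.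
Variables (k : fieldType) (d e : nat).
Local Notation n := (d + e)%N.
Local Notation S := {mpoly k[d + d + e]}.
Local Notation P := {mpoly k[nvars n]}.
Implicit Types (a b c g i j : 'I_n).

Definition row1 a : S := Lmx k d e ord0 a.
Definition row2 a : S := Lmx k d e ord_max a.

Lemma Delta_rows a b : Delta k a b = row1 a * row2 b - row1 b * row2 a.
Proof.
rewrite /Delta /row1 /row2; move: (Lmx k d e) => M.
rewrite (expand_det_row _ ord0) !big_ord_recl big_ord0 /cofactor !det_mx11 !mxE /=.
rewrite (_ : lift ord0 0 = ord_max :> 'I_2); last exact/val_inj.
rewrite !(tnth_nth a) /= addn0 addr0 expr0 expr1; ring.
Qed.

Lemma row1_lshift (j : 'I_d) : row1 (lshift e j) = yvar1 k e j.
Proof.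
rewrite /row1 /Lmx row_mxEl; apply: etrans (_ : col_mx _ _ (lshift 1 ord0) j = _).
  by congr (fun_of_matrix _ _ _); apply: val_inj.
by rewrite col_mxEu mxE.
Qed.

Lemma row2_lshift (j : 'I_d) : row2 (lshift e j) = yvar2 k e j.
Proof.
rewrite /row2 /Lmx row_mxEl; apply: etrans (_ : col_mx _ _ (rshift 1 ord0) j = _).
  by congr (fun_of_matrix _ _ _); apply: val_inj.
by rewrite col_mxEd mxE.
Qed.

Lemma row1_rshift (i : 'I_e) : row1 (rshift d i) = xvar k d i.
Proof.
rewrite /row1 /Lmx row_mxEr; apply: etrans (_ : col_mx _ _ (lshift 1 ord0) i = _).
  by congr (fun_of_matrix _ _ _); apply: val_inj.
by rewrite col_mxEu mxE.
Qed.

Lemma row2_rshift (i : 'I_e) : row2 (rshift d i) = xvar_next k d i.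
Proof.
rewrite /row2 /Lmx row_mxEr; apply: etrans (_ : col_mx _ _ (rshift 1 ord0) i = _).
  by congr (fun_of_matrix _ _ _); apply: val_inj.
by rewrite col_mxEd mxE.
Qed.

Lemma row2_hankel a : (d <= a)%N -> (a.+1 < n)%N -> row1 (ordS a) = row2 a.
Proof.
case: (split_ordP a) => [j ->|i ->] /= da an.
  by have := ltn_ord j; lia.
rewrite row2_rshift /xvar_next; case: insubP => [i' ie ei|/negP[]]; last by lia.
rewrite -row1_rshift; congr row1; apply: val_inj.
by rewrite /= ei addnS modn_small.
Qed.

Lemma row2_last a : (d <= a)%N -> a.+1 = n -> row2 a = 0.
Proof.
case: (split_ordP a) => [j ->|i ->] /= da an.
  by have := ltn_ord j; lia.
by rewrite row2_rshift /xvar_next insubF //; lia.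
Qed.

Lemma pi_F_Tvar a b : (a < b)%N -> pi_F (Tvar k a b) = Delta k a b.
Proof.
move=> ab; rewrite (Tvar_lt k ab) /pi_F comp_mpolyXU -tnth_nth tnth_mktuple.
by rewrite enum_rankK.
Qed.

Lemma PLU_ker a b c g : (a < b < c)%N -> (c < g)%N -> ker_pi_F (PLU k a b c g).
Proof.
move=> abc cg; rewrite /ker_pi_F /PLU /pi_F.
rewrite !(rmorphD, rmorphN, rmorphM) /= -!/(pi_F _) !pi_F_Tvar; try lia.
rewrite !Delta_rows; ring.
Qed.

(** Laplace expansion along the first two rows of the 4 by 4 determinant with rows [v_j], [w_j],
    [v_{j+1}], [w_{j+1}] for [j] in [a, b, c, g]. It vanishes because [v_{j+1} = w_j] repeats a
    row. *)
Lemma LAP_ker a b c g : (d <= a)%N -> (a < b < c)%N -> (c < g)%N -> (g.+1 < n)%N ->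
  ker_pi_F (LAP k a b c g).
Proof.
move=> da abc cg gn.
have [sa sb sc sg] : [/\ ordS a = a.+1 :> nat, ordS b = b.+1 :> nat,
    ordS c = c.+1 :> nat & ordS g = g.+1 :> nat] by split; apply: ordS_lt; lia.
rewrite /ker_pi_F /LAP /pi_F.
rewrite !(rmorphD, rmorphN, rmorphM) /= -!/(pi_F _) !pi_F_Tvar ?sa ?sb ?sc ?sg; try lia.
rewrite !Delta_rows !row2_hankel; try lia.
ring.
Qed.

(** The same expansion with a zero column appended after the last one, consistent with [w_g = 0]:
    the minors involving it drop out. *)
Lemma LAP_last_ker a b c g : (d <= a)%N -> (a < b < c)%N -> (c < g)%N -> g.+1 = n ->
  ker_pi_F (LAP_last k a b c g).
Proof.
move=> da abc cg gn.
have [sa sb sc] : [/\ ordS a = a.+1 :> nat, ordS b = b.+1 :> nat &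
    ordS c = c.+1 :> nat] by split; apply: ordS_lt; lia.
rewrite /ker_pi_F /LAP_last /pi_F.
rewrite !(rmorphD, rmorphN, rmorphM) /= -!/(pi_F _) !pi_F_Tvar ?sa ?sb ?sc; try lia.
rewrite !Delta_rows (@row2_last g) ?row2_hankel; try lia.
ring.
Qed.

Lemma plucker_laplace_ker f : @plucker_laplace k d e f -> ker_pi_F f.
Proof.
case=> [[a [b [c [g [abc [cg ->]]]]]]|[a [b [c [g [da abc cg]]]]]]; first exact: PLU_ker.
by case=> -[gn ->]; [apply: LAP_ker | apply: LAP_last_ker].
Qed.

Local Notation lo := (@edge_lo d e).
Local Notation hi := (@edge_hi d e).
Local Notation standard := (std d lo hi).

Lemma edge_lohi t : (lo t < hi t)%N.
Proof. exact: (valP (enum_val t)). Qed.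

Lemma edge_hi_lt t : (hi t < n)%N.
Proof. exact: ltn_ord. Qed.

Lemma edge_inj s t : lo s = lo t -> hi s = hi t -> s = t.
Proof.
move=> el eh; apply: enum_val_inj; apply: val_inj.
by rewrite [LHS]surjective_pairing [RHS]surjective_pairing; congr (_, _); apply: val_inj.
Qed.

(** The specialization [th] carries the matrix to the columns [(v_j, w_j)] of the independence
    result, taken with [l] the last column. If [e = 0] it sends the last lower entry to zero;
    otherwise this entry is zero already. *)
Lemma standard_indep (f : P) : (0 < n)%N ->
  (forall m, m \in msupp f -> standard m) -> pi_F f = 0 -> f = 0.
Proof.
move=> n0 fs f0.
pose l := n.-1; have ln : (l < n)%N by rewrite prednK.
pose V := vcol k d n 0 l; pose W := wcol k n 0 l.
pose th : (d + d + e).-tuple {mpoly k[(n + n).+1]} :=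
  [tuple match split x with
         | inl y => match split y with inl j => V j | inr j => W j end
         | inr i => V (d + i)%N end | x < d + d + e].
have th1 a : row1 a \mPo th = V a.
  case: (split_ordP a) => [j ->|i ->]; rewrite ?row1_lshift ?row1_rshift.
    rewrite /yvar1 comp_mpolyXU -tnth_nth tnth_mktuple.
    by rewrite -/(unsplit (inl _)) unsplitK -/(unsplit (inl _)) unsplitK.
  rewrite /xvar comp_mpolyXU -tnth_nth tnth_mktuple.
  by rewrite -/(unsplit (inr _)) unsplitK.
have th2 a : row2 a \mPo th = W a.
  case: (leqP d a) => [da|ad]; last first.
    case: (split_ordP a) ad => [j -> _|i -> /=]; last by lia.
    rewrite row2_lshift /yvar2 comp_mpolyXU -tnth_nth tnth_mktuple.
    by rewrite -/(unsplit (inl _)) unsplitK -/(unsplit (inr _)) unsplitK.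
  have := ltn_ord a; rewrite leq_eqVlt => /orP[/eqP an|an].
    by rewrite row2_last // comp_mpoly0 /W wcol_eq0 //; lia.
  by rewrite -row2_hankel // th1 ordS_lt // /V /vcol leqNgt ltnS da.
apply: (@std_indep k (nvars n) d n lo hi edge_lohi edge_hi_lt edge_inj _ l) => //.
- exact: leq_addr.
- by move=> m /fs sm; split=> // t _; have := edge_hi_lt t; rewrite /l; lia.
rewrite -(comp_mpoly0 th) -f0 /pi_F; apply/esym; apply: comp_mpoly_comp => t.
by rewrite !tnth_mktuple Delta_rows comp_mpolyB !rmorphM /= !th1 !th2.
Qed.

End Kernel.

(** * Reduction to standard monomials *)

Section NormalForm.
Variables (k : fieldType) (d e : nat).
Local Notation n := (d + e)%N.
Local Notation P := {mpoly k[nvars n]}.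
Local Notation mon := 'X_{1..nvars n}.
Local Notation standard := (std d (@edge_lo d e) (@edge_hi d e)).

HB.instance Definition _ := GRing.RMorphism.copy (@pi_F k d e)
  (comp_mpoly [tuple Delta k (val (enum_val i)).1 (val (enum_val i)).2 | i < nvars n]).

Lemma pi_F_sum_supp (f : P) :
  pi_F f = \sum_(m <- msupp f) f@_m *: pi_F 'X_[m].
Proof. exact: comp_mpolyEX. Qed.

Lemma pi_FZ x (f : P) : pi_F (x *: f) = x *: pi_F f.
Proof. exact: comp_mpolyZ. Qed.

Lemma nonstandard_leads (m : mon) : ~~ standard m ->
  exists (f : P) u m', [/\ plucker_laplace f, leads f u & m = (u + m')%MM].
Proof.
case/forallPn => s /forallPn[t]; rewrite negb_imply negbK => /andP[/andP[ms mt] st].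
have [f Gf fl] := @forbidden_leads k d e s t st.
(* A forbidden pair consists of distinct edges, so their product divides [m] as soon as each of them
   does. *)
have ne : s != t.
  apply: contraTneq st => <-; rewrite /forbidden; have := edge_lohi s; lia.
have [m1 e1] := mnm_subU ms.
have m1t : (0 < m1 t)%N by move: mt; rewrite e1 mnmDE mnm1E (negbTE ne).
have [m2 e2] := mnm_subU m1t.
by exists f, (U_(s) + U_(t))%MM, m2; split=> //; rewrite e1 e2 addmA.
Qed.

Definition reduces (m : mon) : Prop := exists2 f : P, pi_F f = pi_F 'X_[m] &
  forall v, v \in msupp f -> standard v /\ plucker_le v m.

Lemma reduces_poly (f : P) (u : mon) : below u f ->
  (forall m, m \in msupp f -> reduces m) ->
  exists2 g : P, pi_F g = pi_F f & forall v, v \in msupp g -> standard v /\ plucker_lt v u.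
Proof.
move=> fu fr; rewrite pi_F_sum_supp.
rewrite /below in fu; elim: (msupp f) fu fr => [|m s IH] fu fr.
  by exists 0; rewrite ?big_nil ?rmorph0 // => v; rewrite msupp0.
have [||g eg gs] := IH.
- by move=> v vs; apply: fu; rewrite in_cons vs orbT.
- by move=> v vs; apply: fr; rewrite in_cons vs orbT.
have [|h eh hs] := fr m; first by rewrite in_cons eqxx.
exists (f@_m *: h + g).
  by rewrite big_cons rmorphD /= pi_FZ eh eg.
move=> v /msuppD_le; rewrite mem_cat => /orP[/msuppZ_le|/gs //].
move=> /hs[sv vm]; split=> //.
have mu : plucker_lt m u by apply: fu; rewrite in_cons eqxx.
by case/orP: vm => [/eqP-> //|vm]; apply: plucker_lt_trans vm mu.
Qed.

(** Induction on the number of smaller monomials of degree less than [B]. The bound [B] stays fixed,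
    as no smaller monomial has larger degree. *)
Lemma reducesP m : reduces m.
Proof.
have [B mB] : exists B, (mdeg m < B)%N by exists (mdeg m).+1.
pose lower (v : mon) := #|[pred x : bmultinom (nvars n) B | plucker_lt x v]|.
have [c] := ubnP (lower m); elim: c m mB => // c IH m mB lc.
have [sm|/nonstandard_leads[f [u [m' [Gf [x [r [x0 ef ru]]] em]]]]] := boolP (standard m).
  exists 'X_[m] => // v; rewrite msuppX inE => /eqP->.
  by rewrite /plucker_le eqxx.
have lowered v : plucker_lt v m -> reduces v.
  move=> vm; have vB : (mdeg v < B)%N by apply: leq_ltn_trans (plucker_lt_mdeg vm) mB.
  apply: IH => //; rewrite ltnS in lc; apply: leq_trans _ lc.
  apply: proper_card; apply/properP; split.
    by apply/subsetP => w; rewrite !inE => wv; apply: plucker_lt_trans wv vm.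
  by exists (BMultinom vB); rewrite !inE ?plucker_lt_irr.
(* Modulo the relation [x X_u + r], the monomial [X_m = X_u X_m'] becomes [- x^-1 r X_m'], all of
   whose terms are smaller. *)
have rm : below m (- x^-1 *: (r * 'X_[m'])).
  move=> v /msuppZ_le; rewrite (perm_mem (msuppMX _ _)) => /mapP[w wr ->].
  by rewrite em addmC; apply: plucker_lt_add; apply: ru.
have [|g eg gs] := reduces_poly rm; first by move=> v /rm /lowered.
exists g; last by move=> v /gs[sv vm]; rewrite /plucker_le vm orbT.
rewrite eg pi_FZ rmorphM /= em mpolyXD [RHS]rmorphM /=.
have /eqP := plucker_laplace_ker Gf; rewrite ef rmorphD /= pi_FZ addrC addr_eq0.
move/eqP => ->.
by rewrite mulNr scaleNr scalerN opprK -scalerAl scalerA mulVf // scale1r.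
Qed.

(** If [m] were standard, reducing the lower terms of [f] would give a standard element of the
    kernel in which [m] keeps its nonzero coefficient, against independence. *)
Lemma lead_monomial_nonstandard (f : P) m : (0 < n)%N ->
  ker_pi_F f -> is_lead_monomial (plucker_order n) f m -> ~~ standard m.
Proof.
move=> n0 kf /lead_monomial_leads[x [r [x0 ef rm]]]; apply/negP => sm.
have [|g eg gs] := reduces_poly rm; first by move=> v _; apply: reducesP.
have e0 : x *: 'X_[m] + g = 0.
  apply: (standard_indep n0) => [v|].
    move=> /msuppD_le; rewrite mem_cat => /orP[/msuppZ_le|/gs[] //].
    by rewrite msuppX inE => /eqP->.
  by rewrite rmorphD /= eg -rmorphD -ef.
have : (x *: 'X_[m] + g)@_m = 0 by rewrite e0 mcoeff0.
rewrite mcoeffD mcoeffZ mcoeffX eqxx mulr1 memN_msupp_eq0 ?addr0 => [/eqP|].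
  by rewrite (negbTE x0).
by apply/negP => /gs[_]; rewrite plucker_lt_irr.
Qed.

End NormalForm.

Theorem theorem6p1 (k : fieldType) (d e : nat) (hde : (3 <= d + e)%N) :
  groebner_basis (plucker_order (d + e))
    (@plucker_laplace k d e) (@ker_pi_F k d e).
Proof.
split=> [|p]; first exact: plucker_laplace_ker.
split; apply: ideal_gen_sub => q [f [m [hf lf ->]]].
  by apply: ideal_gen_incl; exists f, m; split=> //; apply: plucker_laplace_ker.
have n0 : (0 < d + e)%N by apply: leq_trans hde.
(* A leading monomial of the kernel is nonstandard, hence a multiple of the leading monomial of some
   relation. *)
have [g [u [m' [Gg gu ->]]]] := nonstandard_leads k (lead_monomial_nonstandard n0 hf lf).
rewrite addmC mpolyXD; apply: ideal_genM; apply: ideal_gen_incl.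
by exists g, u; split=> //; apply: leads_lead_monomial.
Qed.
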